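(* Let $(X,\|\cdot\|_X)$ be a Banach space. If the dual space $X^\ast$ is a UMD$^+$ space, then $X$ is a UMD$^-$ space and $\mathfrak{s}_p(X)<\infty$ for every $p\in(1,\infty)$.
   Context: Notation. $\mathcal{C}_n=\{-1,1\}^n$, with points written $\delta=(\delta_1,\ldots,\delta_n)$. For a measure space $(\Omega,\mathcal{F},\mu)$, a Banach space $Y$ and $f:\Omega\to Y$, $\|f\|_{L_p(\Omega,\mu;Y)}^p=\int_\Omega\|f(\omega)\|_Y^p\,d\mu(\omega)$. UMD$^+$ and UMD$^-$: A Banach space $Y$ is a UMD$^+$ space if for every $p\in(1,\infty)$ there is $\beta_p^+\in(0,\infty)$ such that for every $n\in\mathbb{N}$, every probability space $(\Omega,\mathcal{F},\mu)$, every filtration $\{\mathcal{F}_i\}_{i=0}^n$ of sub-$\sigma$-algebras of $\mathcal{F}$ and every martingale $\{M_i:\Omega\to Y\}_{i=0}^n$ adapted to $\{\mathcal{F}_i\}_{i=0}^n$ (with $M_i\in L_p(\Omega,\mu;Y)$), $$\Big(\frac1{2^n}\sum_{\delta\in\mathcal{C}_n}\Big\|\sum_{i=1}^n\delta_i(M_i-M_{i-1})\Big\|_{L_p(\Omega,\mu;Y)}^p\Big)^{1/p}\leq\beta_p^+\|M_n-M_0\|_{L_p(\Omega,\mu;Y)}.$$ $Y$ is a UMD$^-$ space if for every $p\in(1,\infty)$ there is $\beta_p^-\in(0,\infty)$ such that for all such martingales $$\|M_n-M_0\|_{L_p(\Omega,\mu;Y)}\leq \beta_p^-\Big(\frac1{2^n}\sum_{\delta\in\mathcal{C}_n}\Big\|\sum_{i=1}^n\delta_i(M_i-M_{i-1})\Big\|_{L_p(\Omega,\mu;Y)}^p\Big)^{1/p}.$$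 The parameter $\mathfrak{s}_p(X)\in(0,\infty]$ is the least $\mathfrak{s}\in(0,\infty]$ such that for every probability space $(\Omega,\mathcal{F},\mu)$, every $n\in\mathbb{N}$, every filtration $\{\mathcal{F}_i\}_{i=1}^n$ of sub-$\sigma$-algebras of $\mathcal{F}$ with corresponding vector valued conditional expectations $E_i=\mathbb{E}[\,\cdot\,|\mathcal{F}_i]$, every sequence of functions $f_1,\ldots,f_n:\Omega\to X$ (in $L_p(\Omega,\mu;X)$) satisfies $$\Big(\frac1{2^n}\sum_{\delta\in\mathcal{C}_n}\Big\|\sum_{i=1}^n\delta_i E_i f_i\Big\|_{L_p(\Omega,\mu;X)}^p\Big)^{1/p}\leq\mathfrak{s}\Big(\frac1{2^n}\sum_{\delta\in\mathcal{C}_n}\Big\|\sum_{i=1}^n\delta_i f_i\Big\|_{L_p(\Omega,\mu;X)}^p\Big)^{1/p}.$$ *)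

(* Defs.v *)
From HB Require Import structures.
From mathcomp Require Import all_boot all_order all_algebra.
From mathcomp Require Import all_classical all_reals all_analysis.

Set Implicit Arguments.
Unset Strict Implicit.
Unset Printing Implicit Defensive.

Import Order.TTheory GRing.Theory Num.Theory.
Import numFieldNormedType.Exports.

Local Open Scope classical_set_scope.
Local Open Scope ring_scope.

Section dual_space.
Context {R : realType} {X : normedModType R}.

Definition dual_pred : {pred X -> R^o} :=
  mem [set f : X -> R^o | linear f /\ continuous f].

Record dual := Dual { dual_fun :> X -> R^o; dualP : dual_fun \in dual_pred }.

HB.instance Definition _ := [isSub for dual_fun].
HB.instance Definition _ := [Choice of dual by <:].

Lemma dual_submod_closed : submod_closed dual_pred.
Proof.
split=> [|a f g].
  apply/mem_set; split; last by move=> x; exact: cvg_cst.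
  by move=> a x y; rewrite /= scaler0 addr0.
move=> /set_mem[lf cf] /set_mem[lg cg]; apply/mem_set; split.
- move=> b x y; rewrite -[LHS]/(a *: f _ + g _) lf lg.
  rewrite -[RHS]/(b *: (a *: f x + g x) + (a *: f y + g y)).
  by rewrite !scalerDr !scalerA (mulrC a b) addrACA.
- by move=> x; apply: cvgD; [apply: cvgZl_tmp; exact: cf | exact: cg].
Qed.

HB.instance Definition _ :=
  GRing.isSubmodClosed.Build R (X -> R^o) dual_pred dual_submod_closed.
HB.instance Definition _ := [SubChoice_isSubLmodule of dual by <:].

Lemma dual_linear (f : dual) : linear f.
Proof. by case: f => f /= /set_mem[]. Qed.

HB.instance Definition _ (f : dual) :=
  GRing.isLinear.Build R X R^o _ f (dual_linear f).

Lemma dual_continuous (f : dual) : continuous f.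
Proof. by case: f => f /= /set_mem[]. Qed.

Definition dual_norm (f : dual) : R :=
  sup [set `|f x| | x in [set x | `|x| <= 1]].

Lemma dual_has_sup (f : dual) :
  has_sup [set `|f x| | x in [set x | `|x| <= 1]].
Proof.
split; first by exists `|f 0|, 0 => //=; rewrite normr0.
have /bounded_funP/(_ 1)[M fM] := 
  continuous_linear_bounded 0 (@dual_continuous f 0).
by exists M => _ [x /= x1 <-]; exact: fM.
Qed.

Lemma dual_norm_ler (f : dual) (x : X) : `|f x| <= dual_norm f * `|x|.
Proof.
have [->|x0] := eqVneq x 0; first by rewrite raddf0 !normr0 mulr0.
have nx : 0 < `|x| by rewrite normr_gt0.
rewrite -ler_pdivrMr//; apply: ub_le_sup; first by case: (dual_has_sup f).
exists (`|x|^-1 *: x).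
  by rewrite /= normrZ normfV normr_id mulVf// normr_eq0.
by rewrite linearZ/= normrZ normfV normr_id mulrC.
Qed.

Lemma dual_norm_le (f : dual) (M : R) : 0 <= M ->
  (forall x, `|f x| <= M * `|x|) -> dual_norm f <= M.
Proof.
move=> M0 fM; apply: ge_sup; first by case: (dual_has_sup f).
by move=> _ [x /= x1 <-]; rewrite (le_trans (fM x))// ler_piMr.
Qed.

Lemma dual_norm_ge0 (f : dual) : 0 <= dual_norm f.
Proof.
apply: (@le_trans _ _ `|f 0|) => //; apply: ub_le_sup.
  by case: (dual_has_sup f).
by exists 0 => //=; rewrite normr0.
Qed.

Lemma dual_normD (f g : dual) :
  dual_norm (f + g) <= dual_norm f + dual_norm g.
Proof.
apply: dual_norm_le => [|x]; first by rewrite addr_ge0// dual_norm_ge0.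
rewrite mulrDl (le_trans (ler_normD (f x) (g x)))//.
by rewrite lerD// dual_norm_ler.
Qed.

Lemma dual_normZ (a : R) (f : dual) : dual_norm (a *: f) = `|a| * dual_norm f.
Proof.
have le b h : dual_norm (b *: h) <= `|b| * dual_norm h.
  apply: dual_norm_le => [|x]; first by rewrite mulr_ge0// dual_norm_ge0.
  rewrite (_ : (b *: h) x = b *: h x)// normrZ -mulrA.
  by rewrite ler_wpM2l// dual_norm_ler.
apply/eqP; rewrite eq_le le/=.
have [->|a0] := eqVneq a 0; first by rewrite normr0 mul0r dual_norm_ge0.
rewrite -ler_pdivlMl ?normr_gt0// -normfV.
by rewrite (le_trans _ (le _ _))// scalerA mulVf// scale1r.
Qed.

Lemma dual_norm_eq0 (f : dual) : dual_norm f = 0 -> f = 0.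
Proof.
move=> f0; apply/val_inj/funext => x /=.
by apply/eqP; rewrite -normr_le0 (le_trans (dual_norm_ler f x))// f0 mul0r.
Qed.

HB.instance Definition _ :=
  Lmodule_isNormed.Build R dual dual_normD dual_normZ dual_norm_eq0.

Lemma dual_normE (f : dual) :
  `|f| = sup [set `|f x| | x in [set x | `|x| <= 1]].
Proof. by []. Qed.

Lemma ler_dual_norm (f : dual) (x : X) : `|f x| <= `|f| * `|x|.
Proof. exact: dual_norm_ler. Qed.

Lemma dual_complete (F : set_system dual) :
  ProperFilter F -> cauchy F -> cvg F.
Proof.
move=> FF Fc.
have near_x e x : 0 < e -> exists2 f : dual, F (ball f e) &
    forall h : dual, ball f e h -> `|f x - h x| <= e * `|x|.
  move=> e0; have [f Ff] := (cauchyP _).1 Fc _ e0; exists f => // h.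
  rewrite -ball_normE /ball_/= => fh.
  rewrite (_ : f x - h x = (f - h) x)// (le_trans (ler_dual_norm _ _))//.
  by rewrite ler_wpM2r// ltW.
have cvgx x : cvg ((fun f : dual => f x) @ F).
  apply: cauchy_cvg; apply: cauchy_exP => e e0.
  have d0 : 0 < e / (1 + `|x|) by rewrite divr_gt0// ltr_pwDl.
  have [f Ff fh] := near_x _ x d0; exists (f x).
  rewrite nbhs_filterE; apply: (@filterS _ F) Ff => h /fh fhx.
  apply: (le_lt_trans fhx).
  by rewrite mulrAC -mulrA gtr_pMr// ltr_pdivrMr ?ltr_pwDl// mul1r ltrDr.
pose g x := lim ((fun f : dual => f x) @ F).
have gx x : (fun f : dual => f x) @ F --> g x by exact: cvgx.
have lg : linear g.
  move=> a x y; apply: (cvg_unique _ (gx (a *: x + y))) => /=; first exact: Rhausdorff.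
  have h : (fun f : dual => a *: f x + f y) @ F --> a *: g x + g y.
    by apply: cvgD => //; exact: cvgZl_tmp.
  by apply: cvg_trans h; apply: near_eq_cvg; apply: nearW => f; rewrite linearP.
have close e (f : dual) x : 0 < e -> F (ball f e) -> `|f x - g x| <= e * `|x|.
  move=> e0 Ff; apply/ler_addgt0Pr => d d0.
  have : \forall h \near F, ball f e h /\ `|g x - h x| <= d.
    by apply: filterI => //; have /cvgrPdist_le := gx x; exact.
  move=> /filter_ex[h [fh gh]].
  rewrite -(subrKA (h x)) (le_trans (ler_normD _ _))// lerD 1?distrC//.
  rewrite distrC (_ : f x - h x = (f - h) x)// (le_trans (ler_dual_norm _ _))//.
  by rewrite ler_wpM2r//; move: fh; rewrite -ball_normE => /ltW.
have cg : continuous g.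
  pose gl : {linear X -> R^o} := HB.pack g (GRing.isLinear.Build _ _ _ _ _ lg).
  apply: (@bounded_linear_continuous _ _ _ gl); apply/linear_boundedP.
  have [f Ff] := (cauchyP _).1 Fc _ ltr01.
  near=> r => x; apply: (@le_trans _ _ ((`|f| + 1) * `|x|)); last first.
    by rewrite ler_wpM2r//; near: r; exact: nbhs_pinfty_ge.
  have -> : gl x = f x - (f x - g x) by rewrite opprB addrC subrK.
  rewrite (le_trans (ler_normB _ _))// mulrDl.
  by rewrite lerD ?ler_dual_norm// close.
have gP : g \in dual_pred by apply/mem_set.
apply/cvg_ex; exists (Dual gP); apply/cvgrPdist_le => e e0.
have e20 : 0 < e / 2 by rewrite divr_gt0.
have [f Ff] := (cauchyP _).1 Fc _ e20; apply: filterS (Ff) => h fh.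
rewrite -(subrKA f) (le_trans (ler_normD _ _))// (splitr e) lerD//; last first.
  by move: fh; rewrite -ball_normE => /ltW.
apply: dual_norm_le => [|x]; first exact: ltW.
by rewrite (_ : (_ - f) x = g x - f x)// distrC close.
Unshelve. all: by end_near. Qed.

HB.instance Definition _ := Uniform_isComplete.Build dual dual_complete.


End dual_space.
Arguments dual {R} X.

Section vector_valued_functions.
Context {R : realType} {Y : normedModType R}.
Context {d : measure_display} {T : measurableType d}.
Implicit Types (G : set_system T) (f g : T -> Y).

(* [G] is a sub-sigma-algebra of [d.-measurable], given as a family of sets. *)
Definition simple_for G (s : {fimfun T >-> Y}) :=
  forall y, G (s @^-1` [set y]).

(* Pointwise everywhere: every class of a.e. equal functions that is strongly
   measurable up to null sets has such a representative. *)
Definition strongly_measurable G f :=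
  exists s : nat -> {fimfun T >-> Y},
    (forall k, simple_for G (s k)) /\ forall w, s k w @[k --> \oo] --> f w.

Variable P : probability T R.

Definition simple_integral (A : set T) (s : {fimfun T >-> Y}) : Y :=
  \sum_(y \in range s) fine (P (A `&` s @^-1` [set y])) *: y.

(* [f] is Bochner integrable on [A], with integral [v]. *)
Definition has_bochner_integral (A : set T) f (v : Y) :=
  strongly_measurable d.-measurable f /\
  exists s : nat -> {fimfun T >-> Y},
    [/\ forall k, simple_for d.-measurable (s k),
        (\int[P]_(w in A) `|f w - s k w|%:E @[k --> \oo] --> 0)%E &
        simple_integral A (s k) @[k --> \oo] --> v].

(* [g] is a version of the conditional expectation of [f] given [G]; the case
   [A = setT] makes both functions Bochner integrable. *)
Definition is_cond_expectation G f g :=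
  strongly_measurable G g /\
  forall A, G A ->
    exists v, has_bochner_integral A f v /\ has_bochner_integral A g v.

Definition Lp_norm (p : R) f : \bar R := Lnorm P p%:E (fun w => `|f w|%:E).

Definition in_Lp (p : R) f :=
  strongly_measurable d.-measurable f /\ (Lp_norm p f < +oo)%E.

(* The point of the discrete cube coded by [e] is [delta_i = (-1) ^+ e i]. *)
Definition signed_sum n (e : {ffun 'I_n -> bool}) (x : 'I_n -> T -> Y) :
    T -> Y :=
  fun w => \sum_(i < n) (-1) ^+ e i *: x i w.

Definition cube_average (p : R) n (x : 'I_n -> T -> Y) : \bar R :=
  (((2 ^- n)%:E * \sum_(e : {ffun 'I_n -> bool})
      Lp_norm p (signed_sum e x) `^ p) `^ p^-1)%E.

Definition filtration n (F : 'I_n -> set_system T) :=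
  (forall i, sigma_algebra setT (F i) /\ F i `<=` d.-measurable) /\
  (forall i j : 'I_n, (i <= j)%N -> F i `<=` F j).

Definition martingale n (F : 'I_n -> set_system T) (M : 'I_n -> T -> Y) :=
  (forall i, strongly_measurable (F i) (M i)) /\
  forall i j : 'I_n, (i <= j)%N -> is_cond_expectation (F i) (M j) (M i).

(* [M i.+1 - M i] for [i < n]. *)
Definition martingale_diff n (M : 'I_n.+1 -> T -> Y) (i : 'I_n) : T -> Y :=
  M (lift ord0 i) \- M (widen_ord (leqnSn n) i).

End vector_valued_functions.

Definition umd_plus {R : realType} (Y : completeNormedModType R) :=
  forall p : R, 1 < p -> exists2 b : R, 0 < b &
  forall (n : nat) (d : measure_display) (T : measurableType d)
    (P : probability T R) (F : 'I_n.+1 -> set_system T)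
    (M : 'I_n.+1 -> T -> Y),
    filtration F -> martingale P F M -> (forall i, in_Lp P p (M i)) ->
    (cube_average P p (martingale_diff M) <=
      b%:E * Lp_norm P p (M ord_max \- M ord0)%R)%E.

Definition umd_minus {R : realType} (Y : completeNormedModType R) :=
  forall p : R, 1 < p -> exists2 b : R, 0 < b &
  forall (n : nat) (d : measure_display) (T : measurableType d)
    (P : probability T R) (F : 'I_n.+1 -> set_system T)
    (M : 'I_n.+1 -> T -> Y),
    filtration F -> martingale P F M -> (forall i, in_Lp P p (M i)) ->
    (Lp_norm P p (M ord_max \- M ord0)%R <=
      b%:E * cube_average P p (martingale_diff M))%E.

Definition stein_bound {R : realType} (X : completeNormedModType R) (p : R)
    (s : \bar R) :=
  forall (n : nat) (d : measure_display) (T : measurableType d)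
    (P : probability T R) (F : 'I_n -> set_system T)
    (f Ef : 'I_n -> T -> X),
    filtration F -> (forall i, in_Lp P p (f i)) ->
    (forall i, is_cond_expectation P (F i) (f i) (Ef i)) ->
    (cube_average P p Ef <= s * cube_average P p f)%E.

(* [stein_bound X p] is closed under infima, so this is the least constant
   (except for [X = 0], where every positive [s] is admissible). *)
Definition stein_constant {R : realType} (X : completeNormedModType R)
    (p : R) : \bar R :=
  ereal_inf [set s : \bar R | (0 < s)%E /\ stein_bound X p s].

(* Main.v *)
From HB Require Import structures.
From mathcomp Require Import all_boot all_order all_algebra.
From mathcomp Require Import all_classical all_reals all_analysis.
From mathcomp Require Import finmap measurable_realfun ring lra.
Require Import Defs.
Set Implicit Arguments.
Unset Strict Implicit.
Unset Printing Implicit Defensive.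
Import Order.TTheory GRing.Theory Num.Theory.
Import numFieldNormedType.Exports.
Local Open Scope ring_scope.

(** The whole argument is one duality.  Let (A_k) be a filtration, E_k its
    conditional expectations and D_k = E_(k+1) - E_k.  The UMD^+ inequality for the
    dual X' says that g |-> (D_k g)_k is bounded from L_q(X') to the Rademacher sums
    of L_q(X').  Since the D_k are self-adjoint, the adjoint map
    (F_k)_k |-> sum_k D_k F_k is bounded from the Rademacher sums of L_p(X) to
    L_p(X) (finite_umd_plus_dual).

    Applied to F_k = D_k f this is the UMD^- inequality (finite_umd_minus).  For
    Stein's inequality, let delta be uniform on the cube and independent of the
    filtration, and reveal alternately a new sigma-algebra of the filtration and a
    new sign: level 2i of the refined filtration sees A_0, ..., A_i and
    delta_0, ..., delta_(i-1), and level 2i+1 also sees delta_i.  Then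
    D_(2i) (delta_i f_i) = delta_i E_i f_i, so the adjoint inequality bounds
    sum_i delta_i E_i f_i by sum_i delta_i f_i (finite_stein).

    Both applications are made on finite probability spaces, where conditional
    expectations are averages over the cells of a partition, the norm of L_p(X) is
    attained on X'-valued functions by the Hahn-Banach theorem, and Young's
    inequality can play the part of Hoelder's (young_absorb).

    The passage to arbitrary probability spaces is by approximation in L_p.  Each
    function in play is replaced by a simple function measurable for the same
    sigma-algebra (simple_dense); finitely many simple functions factor through a
    finite set (code), and averages over the cells of the resulting partitions
    approximate the given conditional expectations (condexp_coded_dist,
    averaged_approx), because a conditional expectation has the same integral as
    the function over each cell.  For Stein's inequality the conditional
    expectations must first be shown to lie in L_p (cond_expectation_in_Lp). *)

(** * Norming functionals *)

Section hahn_banach.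
Context {R : realType} {X : normedModType R}.
Implicit Types (p q : X -> R) (x y : X).

Definition sublinear p :=
  (forall x y, p (x + y) <= p x + p y) /\
  (forall (t : R) x, 0 <= t -> p (t *: x) <= t * p x).

Lemma sublinear0 p : sublinear p -> p 0 = 0.
Proof.
move=> [pD pZ]; apply/eqP; rewrite eq_le; apply/andP; split.
  by have := pZ 0 0 (lexx _); rewrite scaler0 mul0r.
by have := pD 0 0; rewrite addr0 -subr_ge0 addrK.
Qed.

Lemma sublinearZ p (t : R) x : sublinear p -> 0 <= t -> p (t *: x) = t * p x.
Proof.
move=> sp; rewrite le_eqVlt => /predU1P[<-|t0].
  by rewrite scale0r mul0r sublinear0.
case: (sp) => pD pZ; apply/eqP; rewrite eq_le (pZ _ _ (ltW t0))/=.
rewrite -ler_pdivlMl//.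
have tV0 : 0 <= t^-1 by rewrite invr_ge0 ltW.
by have := pZ t^-1 (t *: x) tV0; rewrite scalerA mulVf ?gt_eqF// scale1r.
Qed.

Lemma sublinear_leN p x : sublinear p -> - p (- x) <= p x.
Proof.
move=> sp; have := sp.1 x (- x); rewrite subrr sublinear0//.
by rewrite -lerBlDr sub0r.
Qed.

(** This is the largest sublinear functional below [p] whose value at [- y] is at
    most [- p y].  A minimal sublinear functional equals all its tilts, which makes
    it additive; and below the tilt of the norm along x0, a functional f satisfies
    f (- x0) <= - |x0|. *)
Definition tilt p y x : R :=
  inf [set p (x + t *: y) - t * p y | t in [set t : R | 0 <= t]].

Lemma tilt_le p y x (t : R) : sublinear p -> 0 <= t ->
  tilt p y x <= p (x + t *: y) - t * p y.
Proof.
move=> sp t0; apply: ge_inf; last by exists t.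
exists (- p (- x)) => _ [s /= s0 <-].
rewrite -sublinearZ// lerBrDr addrC lerBlDr.
by have := sp.1 (x + s *: y) (- x); rewrite addrAC subrr add0r.
Qed.

Lemma tilt_ge p y x a :
  (forall t : R, 0 <= t -> a <= p (x + t *: y) - t * p y) -> a <= tilt p y x.
Proof.
move=> h; apply: lb_le_inf; first by exists (p (x + 0 *: y) - 0 * p y); exists 0 => /=.
by move=> _ [t /= t0 <-]; exact: h.
Qed.

Lemma tilt_sublinear p y : sublinear p -> sublinear (tilt p y).
Proof.
move=> sp; split=> [u v|t x].
  rewrite -lerBlDr; apply: tilt_ge => t t0; rewrite lerBlDl -lerBlDr.
  apply: tilt_ge => s s0; rewrite lerBlDr.
  apply: (le_trans (@tilt_le p y _ (s + t) sp _)); first exact: addr_ge0.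
  have := sp.1 (v + s *: y) (u + t *: y).
  rewrite (_ : v + _ + _ = u + v + (s + t) *: y); last first.
    by rewrite scalerDl addrACA (addrC u).
  lra.
rewrite le_eqVlt => /predU1P[<-|t0].
  rewrite mul0r scale0r (le_trans (@tilt_le p y _ 0 sp _))//.
  by rewrite scale0r addr0 sublinear0// mul0r subr0.
rewrite -ler_pdivrMl//; apply: tilt_ge => s s0; rewrite ler_pdivrMl//.
apply: (le_trans (@tilt_le p y _ (t * s) sp _)).
  exact: mulr_ge0 (ltW t0) s0.
by rewrite -scalerA -scalerDr (sublinearZ _ sp (ltW t0)) mulrBr mulrA.
Qed.

Lemma tilt_le_id p y x : sublinear p -> tilt p y x <= p x.
Proof.
move=> sp; apply: (le_trans (@tilt_le p y _ 0 sp _)) => //.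
by rewrite scale0r addr0 mul0r subr0.
Qed.

(** Zorn's lemma applies because the pointwise infimum of a chain of sublinear
    functionals is sublinear. *)
Lemma minimal_sublinear q : sublinear q ->
  exists f, [/\ sublinear f, forall x, f x <= q x &
    forall p, sublinear p -> (forall x, p x <= f x) -> p = f].
Proof.
move=> sq.
pose T := {p : X -> R | sublinear p /\ forall x, p x <= q x}.
pose le' (a b : T) : bool := `[< forall x, sval b x <= sval a x >].
have [] := @Zorn T le'.
- by move=> t; apply/asboolP.
- move=> r s t /asboolP rs /asboolP st; apply/asboolP => x.
  exact: le_trans (st x) (rs x).
- move=> [s ss] [t tt] /asboolP/= st /asboolP/= ts; apply: eq_exist.
  by apply/funext => x; apply/eqP; rewrite eq_le st ts.
- move=> A tot; have [[a0 Aa0]|A0] := pselect (exists a, A a); last first.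
    by exists (exist _ q (conj sq (fun x => lexx _))) => s As; case: A0; exists s.
  pose m x := inf [set sval a x | a in A].
  have lb x : has_lbound [set sval a x | a in A].
    exists (- q (- x)) => _ [a _ <-]; case: (svalP a) => sa aq.
    by rewrite (le_trans _ (@sublinear_leN _ x sa))// lerN2 aq.
  have mle a x : A a -> m x <= sval a x.
    by move=> Aa; apply: ge_inf => //; exists a.
  have mge b x : (forall a, A a -> b <= sval a x) -> b <= m x.
    move=> h; apply: lb_le_inf; first by exists (sval a0 x), a0.
    by move=> _ [a Aa <-]; exact: h.
  have sm : sublinear m.
    split=> [x y|t x t0].
      rewrite -lerBlDr; apply: (mge _ _) => a Aa; rewrite lerBlDl -lerBlDr.
      apply: (mge _ _) => b Ab; rewrite lerBlDr.
      have [/asboolP ab|/asboolP ba] := tot _ _ Aa Ab.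
      + apply: (le_trans (mle _ _ Ab)); apply: (le_trans ((svalP b).1.1 _ _)).
        by rewrite addrC lerD2l ab.
      + apply: (le_trans (mle _ _ Aa)); apply: (le_trans ((svalP a).1.1 _ _)).
        by rewrite addrC lerD2r ba.
    move: t0; rewrite le_eqVlt => /predU1P[<-|t0].
      rewrite mul0r scale0r (le_trans (mle _ _ Aa0))// sublinear0//.
      by case: (svalP a0).
    rewrite -ler_pdivrMl//; apply: (mge _ _) => a Aa; rewrite ler_pdivrMl//.
    by rewrite (le_trans (mle _ _ Aa))//; apply: (svalP a).1.2; exact: ltW.
  have mq x : m x <= q x by apply: (le_trans (mle _ _ Aa0)); case: (svalP a0).
  by exists (exist _ m (conj sm mq)) => s As; apply/asboolP => x; exact: mle.
- move=> [f [sf fq]] fmin; exists f; split=> // p sp pf.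
  have pq x : p x <= q x by rewrite (le_trans (pf x)).
  have := fmin (exist _ p (conj sp pq)).
  by move=> /(_ (asboolT pf))/(congr1 sval).
Qed.

(** The functional is a minimal sublinear one below the tilt of the norm along
    [x0]. *)
Theorem norming_functional x0 :
  exists f : dual X, `|f| <= 1 /\ f x0 = `|x0|.
Proof.
have sn : sublinear (@Num.norm R X).
  by split=> [x y|t x t0]; [exact: ler_normD | rewrite normrZ ger0_norm].
have [f [sf fq fmin]] := minimal_sublinear (tilt_sublinear x0 sn).
have fn x : f x <= `|x| by apply: le_trans (fq x) (tilt_le_id _ _ sn).
have fD x y : f (x + y) = f x + f y.
  apply/eqP; rewrite eq_le sf.1/= -lerBrDr.
  have tf := fmin _ (tilt_sublinear y sf) (fun x => tilt_le_id y x sf).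
  rewrite -{1}tf; apply: (le_trans (@tilt_le _ _ _ 1 sf ler01)).
  by rewrite scale1r mul1r.
have fN x : f (- x) = - f x.
  by apply/eqP; rewrite -addr_eq0 -fD addNr sublinear0.
have fZ t x : f (t *: x) = t * f x.
  have [t0|t0] := leP 0 t; first exact: sublinearZ.
  by rewrite -[t]opprK scaleNr fN sublinearZ ?mulNr// oppr_ge0 ltW.
have lf : linear (f : X -> R^o) by move=> t x y; rewrite fD fZ.
have fabs x : `|f x| <= `|x|.
  by rewrite ler_norml fn andbT lerNl -fN -[leRHS]normrN fn.
have cf : continuous (f : X -> R^o).
  pose fl : {linear X -> R^o} := HB.pack (f : X -> R^o)
    (GRing.isLinear.Build _ _ _ _ _ lf).
  apply: (@bounded_linear_continuous _ _ _ fl); apply/linear_boundedP.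
  exists 1; split=> // r r1 x; apply: (le_trans (fabs x)).
  by rewrite -[leLHS]mul1r ler_wpM2r// ltW.
have fP : (f : X -> R^o) \in dual_pred by apply/mem_set.
exists (Dual fP); split.
  by apply: dual_norm_le => // x; rewrite mul1r fabs.
apply/eqP; rewrite eq_le fn/= -lerN2 -fN (le_trans (fq _))//.
rewrite (le_trans (@tilt_le _ _ _ 1 sn _))//.
by rewrite scale1r addNr normr0 mul1r sub0r.
Qed.

End hahn_banach.

(** * Powers and conjugate exponents *)

Section conjugate_exponents.
Context {R : realType}.

Lemma conjugate_subM (p q : R) : 0 < p -> 0 < q -> p^-1 + q^-1 = 1 ->
  (p - 1) * q = p.
Proof.
move=> p0 q0 pq; have : p * q * (p^-1 + q^-1) = p * q by rewrite pq mulr1.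
by rewrite mulrDr mulfK ?gt_eqF// mulrAC mulfV ?gt_eqF//; lra.
Qed.

Lemma powR_subM (a p : R) : 0 <= a -> 0 < p -> a `^ (p - 1) * a = a `^ p.
Proof.
move=> a0 p0; have [->|aN0] := eqVneq a 0; first by rewrite mulr0 powR0 ?gt_eqF.
rewrite -{2}(powRr1 a0) -powRD ?subrK//.
by apply/implyP => _.
Qed.

(** This is how Young's inequality replaces Hoelder's: it is applied inside a sum
    S, and the part that reproduces S is absorbed in the left-hand side. *)
Lemma young_absorb (p q S H : R) : 0 < p -> p^-1 + q^-1 = 1 ->
  S <= q^-1 * S + p^-1 * H -> S <= H.
Proof.
move=> p0 pq; have pE : 1 - q^-1 = p^-1 by rewrite -pq addrK.
rewrite addrC -lerBlDr -{1}[X in X - _]mul1r -mulrBl pE.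
by rewrite ler_pM2l// invr_gt0.
Qed.

Lemma conjugate_exists (p : R) : 1 < p -> exists2 q : R, 1 < q & p^-1 + q^-1 = 1.
Proof.
move=> p1; have p0 : 0 < p by exact: lt_trans p1.
have pV1 : p^-1 < 1 by rewrite invf_lt1.
have pV0 : 0 < p^-1 by rewrite invr_gt0.
exists (1 - p^-1)^-1; last by rewrite invrK addrC subrK.
by rewrite invf_gt1 ?subr_gt0// gtrBl.
Qed.

End conjugate_exponents.

(** * Conditional expectations on finite weighted sets *)

Section condexp.
Context {R : realType} {Z : finType} (w : Z -> R).
Hypothesis w_ge0 : forall z, 0 <= w z.
Implicit Types (K : eqType) (Y : lmodType R).

Definition class_weight K (pi : Z -> K) x := \sum_(y | pi y == pi x) w y.

(** The conditional expectation given the partition into fibres of [pi].  On a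
    fibre of weight zero it is 0, by the convention for inverses; this is why
    condexp_id is restricted to points of nonzero weight. *)
Definition condexp K (pi : Z -> K) Y (f : Z -> Y) (x : Z) : Y :=
  (class_weight pi x)^-1 *: \sum_(y | pi y == pi x) w y *: f y.

Lemma class_weight_neq0 K (pi : Z -> K) x : w x != 0 -> class_weight pi x != 0.
Proof.
move=> wx; rewrite gt_eqF// (lt_le_trans (_ : 0 < w x))//.
  by rewrite lt_neqAle eq_sym wx w_ge0.
by rewrite /class_weight (bigD1 x)//= lerDl sumr_ge0.
Qed.

Lemma eq_condexp K (pi : Z -> K) Y (f : Z -> Y) x y :
  pi x = pi y -> condexp pi f x = condexp pi f y.
Proof. by move=> xy; rewrite /condexp /class_weight xy. Qed.

Lemma condexp_id K (pi : Z -> K) Y (f : Z -> Y) x : w x != 0 ->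
  (forall y, pi y = pi x -> f y = f x) -> condexp pi f x = f x.
Proof.
move=> wx fx; rewrite /condexp.
rewrite (eq_bigr (fun y => w y *: f x)); last by move=> y /eqP /fx ->.
by rewrite -scaler_suml scalerA mulVf ?scale1r// class_weight_neq0.
Qed.

Lemma condexp_sum K (pi : Z -> K) Y (I : Type) (r : seq I) (P : pred I)
    (f : I -> Z -> Y) x :
  condexp pi (fun z => \sum_(i <- r | P i) f i z) x =
  \sum_(i <- r | P i) condexp pi (f i) x.
Proof.
rewrite /condexp -scaler_sumr exchange_big/=; congr (_ *: _).
by apply: eq_bigr => y _; rewrite scaler_sumr.
Qed.

Lemma condexpD K (pi : Z -> K) Y (f g : Z -> Y) x :
  condexp pi (fun z => f z + g z) x = condexp pi f x + condexp pi g x.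
Proof.
rewrite /condexp -scalerDr -big_split/=; congr (_ *: _).
by apply: eq_bigr => y _; rewrite scalerDr.
Qed.

Lemma condexpN K (pi : Z -> K) Y (f : Z -> Y) x :
  condexp pi (fun z => - f z) x = - condexp pi f x.
Proof.
rewrite /condexp -scalerN -sumrN; congr (_ *: _).
by apply: eq_bigr => y _; rewrite scalerN.
Qed.

Lemma condexpB K (pi : Z -> K) Y (f g : Z -> Y) x :
  condexp pi (fun z => f z - g z) x = condexp pi f x - condexp pi g x.
Proof. by rewrite (condexpD _ f (fun z => - g z)) condexpN. Qed.

Lemma condexp_adjoint K (pi : Z -> K) (Y1 Y2 Y3 : lmodType R)
    (B : Y1 -> Y2 -> Y3) (f : Z -> Y1) (g : Z -> Y2) :
  (forall y, linear (B^~ y)) -> (forall y, linear (B y)) ->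
  \sum_x w x *: B (condexp pi f x) (g x) =
  \sum_x w x *: B (f x) (condexp pi g x).
Proof.
move=> Bl Br.
pose bl y : {linear Y1 -> Y3} := HB.pack (B^~ y)
  (GRing.isLinear.Build _ _ _ _ _ (Bl y)).
pose br y : {linear Y2 -> Y3} := HB.pack (B y)
  (GRing.isLinear.Build _ _ _ _ _ (Br y)).
pose c x y := w x * (class_weight pi x)^-1 * w y.
transitivity (\sum_x \sum_(y | pi y == pi x) c x y *: B (f y) (g x)).
  apply: eq_bigr => x _; rewrite -[B _ _]/(bl (g x) _) linearZ linear_sum/=.
  rewrite scalerA scaler_sumr; apply: eq_bigr => y _.
  by rewrite -[B _ _]/(bl (g x) _) linearZ/= scalerA.
rewrite (exchange_big_dep predT)//=; apply: eq_bigr => x _.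
rewrite -[B (f x) _]/(br (f x) _) linearZ linear_sum/=.
rewrite scalerA scaler_sumr; apply: eq_big => [y|y /eqP xy].
  by rewrite eq_sym.
rewrite -[B _ (_ *: _)]/(br (f x) _) linearZ/= scalerA /c /class_weight xy.
by congr (_ *: _); rewrite mulrAC (mulrC (w y)) mulrAC.
Qed.

(** Conditional expectation is self-adjoint and fixes [phi] at all points of
    nonzero weight; the other points contribute nothing to the sums. *)
Lemma sum_condexp K (pi : Z -> K) Y (phi : Z -> R) (f : Z -> Y) :
  (forall x y, pi x = pi y -> phi x = phi y) ->
  \sum_x w x *: (phi x *: condexp pi f x) = \sum_x w x *: (phi x *: f x).
Proof.
move=> phiE.
rewrite -(@condexp_adjoint _ pi R^o Y Y (fun a y => a *: y) phi f)//; first last.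
- by move=> a b x y; rewrite scalerDr !scalerA (mulrC a).
- by move=> y a b c; rewrite scalerDl -scalerA.
apply: eq_bigr => x _; have [->|wx] := eqVneq (w x) 0; first by rewrite !scale0r.
by rewrite condexp_id// => y /phiE.
Qed.

Lemma condexp_tower K (pi rho : Z -> K) Y (f : Z -> Y) x :
  (forall y z, rho y = rho z -> pi y = pi z) ->
  condexp pi (condexp rho f) x = condexp pi f x.
Proof.
move=> pirho; rewrite /condexp; congr (_ *: _).
rewrite !(big_mkcond (fun y => pi y == pi x))/=.
have E (g : Z -> Y) : \sum_y (if pi y == pi x then w y *: g y else 0) =
    \sum_y w y *: (((pi y == pi x)%:R : R) *: g y).
  apply: eq_bigr => y _.
  by case: ifP => _; rewrite ?scale1r// scale0r scaler0.
rewrite !E.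
by apply: sum_condexp => y z /pirho ->.
Qed.

Lemma ler_norm_condexp K (pi : Z -> K) (Y : normedModType R) (f : Z -> Y) x :
  `|condexp pi f x| <= condexp pi (fun z => `|f z| : R^o) x.
Proof.
have cw0 : 0 <= (class_weight pi x)^-1 by rewrite invr_ge0 sumr_ge0.
rewrite /condexp normrZ ger0_norm// ler_wpM2l//.
apply: (le_trans (ler_norm_sum _ _ _)); apply: ler_sum => y _.
by rewrite normrZ ger0_norm.
Qed.

(** Conditional expectations contract L_q: with m the average of |f|, the sum
    of m^q equals that of m^(q-1) |f| because m^(q-1) is invariant, and Young's
    inequality bounds the latter by a mixture of m^q and |f|^q. *)
Lemma condexp_contraction K (pi : Z -> K) (Y : normedModType R) (f : Z -> Y)
    (p q : R) : 0 < p -> 0 < q -> p^-1 + q^-1 = 1 ->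
  \sum_x w x * `|condexp pi f x| `^ q <= \sum_x w x * `|f x| `^ q.
Proof.
move=> p0 q0 pq.
pose m x := condexp pi (fun z => `|f z| : R^o) x.
have m0 x : 0 <= m x by rewrite (le_trans _ (ler_norm_condexp _ _ _)).
have qp : q^-1 + p^-1 = 1 by rewrite addrC.
have mS : \sum_x w x * m x `^ q = \sum_x w x * (m x `^ (q - 1) * `|f x|).
  rewrite (eq_bigr (fun x => w x * (m x `^ (q - 1) * m x))) => [|x _]; last by rewrite powR_subM.
  apply: (@sum_condexp _ pi R^o (fun x => m x `^ (q - 1))) => x y xy.
  by rewrite /m (eq_condexp _ xy).
have : \sum_x w x * m x `^ q <=
    p^-1 * (\sum_x w x * m x `^ q) + q^-1 * (\sum_x w x * `|f x| `^ q).
  rewrite {1}mS !mulr_sumr -big_split/=; apply: ler_sum => x _.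
  rewrite !(mulrCA _ (w x)) -mulrDr ler_wpM2l//.
  apply: (le_trans (conjugate_powR (powR_ge0 _ _) (normr_ge0 _) p0 q0 pq)).
  by rewrite -powRrM conjugate_subM// (mulrC p^-1) (mulrC q^-1).
move=> /(young_absorb q0 qp); apply: le_trans; apply: ler_sum => x _.
rewrite ler_wpM2l// ge0_ler_powR ?nnegrE ?m0 ?normr_ge0 ?(ltW q0)//.
exact: ler_norm_condexp.
Qed.

End condexp.

Arguments class_weight : simpl never.
Arguments condexp : simpl never.

(** * Rademacher sums *)

Section rademacher.
Context {R : realType} {n : nat}.
Implicit Types (e : {ffun 'I_n -> bool}) (i k : 'I_n).

Definition flip_sign k e : {ffun 'I_n -> bool} :=
  [ffun i => if i == k then ~~ e i else e i].

Lemma flip_signK k : involutive (flip_sign k).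
Proof.
by move=> e; apply/ffunP => i; rewrite !ffunE; case: eqP => // _; rewrite negbK.
Qed.

Lemma signr_flip k e : (-1) ^+ flip_sign k e k = - (-1) ^+ e k :> R.
Proof. by rewrite ffunE eqxx signrN. Qed.

Lemma sum_flip_sign k (Y : lmodType R) (P : pred {ffun 'I_n -> bool})
    (phi : {ffun 'I_n -> bool} -> Y) :
  (forall e, P (flip_sign k e) = P e) ->
  (forall e, phi (flip_sign k e) = - phi e) -> \sum_(e | P e) phi e = 0.
Proof.
move=> Pk phik; set S := LHS.
have SN : S = - S.
  rewrite -sumrN {1}/S (reindex_inj (inv_inj (flip_signK k))).
  by apply: eq_big => e //; rewrite phik.
have : 2 *: S = 0 by rewrite scaler_nat mulr2n {1}SN addNr.
by move/eqP; rewrite scaler_eq0 pnatr_eq0/= => /eqP.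
Qed.

(** For i <> j, flipping the i-th sign changes the sign of the (i, j) term. *)
Lemma rademacher_orthogonality (Y1 Y2 : lmodType R) (B : Y1 -> Y2 -> R)
    (a : 'I_n -> Y1) (b : 'I_n -> Y2) :
  (forall y, scalar (B^~ y)) -> (forall y, scalar (B y)) ->
  2 ^- n * \sum_(e : {ffun 'I_n -> bool})
    B (\sum_i (-1) ^+ e i *: a i) (\sum_i (-1) ^+ e i *: b i) =
  \sum_i B (a i) (b i).
Proof.
move=> Bl Br.
pose bl y : {linear Y1 -> R^o} := HB.pack (B^~ y : Y1 -> R^o)
  (GRing.isLinear.Build _ _ _ _ _ (Bl y)).
pose br y : {linear Y2 -> R^o} := HB.pack (B y : Y2 -> R^o)
  (GRing.isLinear.Build _ _ _ _ _ (Br y)).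
have BE e : B (\sum_i (-1) ^+ e i *: a i) (\sum_i (-1) ^+ e i *: b i) =
    \sum_i \sum_j ((-1) ^+ e i * (-1) ^+ e j) * B (a i) (b j).
  rewrite -[LHS]/(bl _ _) linear_sum/=; apply: eq_bigr => i _.
  rewrite -[LHS]/(br _ _) linear_sum/=; apply: eq_bigr => j _.
  rewrite -[LHS]/(br _ _) linearZ/= -[B _ _]/(bl _ _) linearZ/=.
  by rewrite [LHS]scalerA [in LHS]mulrC.
rewrite (eq_bigr _ (fun e _ => BE e)) exchange_big mulr_sumr/=.
apply: eq_bigr => i _; rewrite exchange_big/= (bigD1 i)//= [X in _ + X]big1.
  rewrite addr0 -mulr_suml (eq_bigr (fun=> 1)) => [|e _].
    rewrite sumr_const card_ffun card_bool card_ord -natrX mulrA mulVf ?mul1r//.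
  by rewrite -expr2 sqrr_sign.
move=> j ji; rewrite -mulr_suml (@sum_flip_sign i R^o predT) ?mul0r// => e.
by rewrite signr_flip mulNr [flip_sign _ _ j]ffunE (negbTE ji).
Qed.

End rademacher.

(** * UMD inequalities on finite sets and their duals *)

Definition refining (Z K : Type) (pi : nat -> Z -> K) :=
  forall i j, (i <= j)%N -> forall x y, pi j x = pi j y -> pi i x = pi i y.

Section finite_umd.
Context {R : realType}.

Definition condexp_diff (Z : finType) (w : Z -> R) (K : eqType)
    (pi : nat -> Z -> K) (Y : lmodType R) k (f : Z -> Y) z : Y :=
  condexp w (pi k.+1) f z - condexp w (pi k) f z.

Arguments condexp_diff : simpl never.

Definition finite_umd_plus (Y : normedModType R) (q b : R) :=
  forall (Z K : finType) (w : Z -> R) (pi : nat -> Z -> K) N (g : Z -> Y),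
  (forall z, 0 <= w z) -> \sum_z w z = 1 -> refining pi ->
  2 ^- N * \sum_(e : {ffun 'I_N -> bool}) \sum_z w z *
    `|\sum_(k < N) (-1) ^+ e k *: condexp_diff w pi k g z| `^ q <=
  b `^ q * \sum_z w z * `|condexp w (pi N) g z - condexp w (pi 0) g z| `^ q.

Lemma ler_powR_normB (Y : normedModType R) (x y : Y) (q : R) : 0 < q ->
  `|x - y| `^ q <= 2 `^ q * (`|x| `^ q + `|y| `^ q).
Proof.
move=> q0.
have aux (u v : Y) : `|u| <= `|v| ->
    `|u - v| `^ q <= 2 `^ q * (`|u| `^ q + `|v| `^ q).
  move=> uv; apply: (@le_trans _ _ ((2 * `|v|) `^ q)).
    rewrite ge0_ler_powR ?nnegrE ?mulr_ge0 ?(ltW q0)// mulr_natl mulr2n.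
    by rewrite (le_trans (ler_normB _ _))// lerD2r.
  by rewrite powRM// ler_wpM2l ?powR_ge0// lerDr powR_ge0.
have [/aux//|/ltW/aux] := leP `|x| `|y|.
by rewrite distrC (addrC (_ `^ q)).
Qed.

(** The functional z |-> |h z|^(p-1) j(h z), with j norming, is what represents
    the norm of h in the dual of L_p. *)
Lemma dual_function (X : normedModType R) (Z : Type) (h : Z -> X) (p q : R) :
  0 < p -> 0 < q -> p^-1 + q^-1 = 1 ->
  exists g : Z -> dual X,
    forall z, `|g z| `^ q <= `|h z| `^ p /\ g z (h z) = `|h z| `^ p.
Proof.
move=> p0 q0 pq.
have [g gP] := choice (fun z => norming_functional (h z)).
exists (fun z => (`|h z| `^ (p - 1)) *: g z) => z; split.
  rewrite normrZ ger0_norm ?powR_ge0//.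
  apply: (@le_trans _ _ ((`|h z| `^ (p - 1)) `^ q)).
    rewrite ge0_ler_powR ?nnegrE ?mulr_ge0 ?powR_ge0 ?(ltW q0)//.
    by rewrite ler_piMr ?powR_ge0//; case: (gP z).
  by rewrite -powRrM conjugate_subM.
rewrite -[LHS]/(`|h z| `^ (p - 1) * g z (h z)) (gP z).2.
exact: powR_subM.
Qed.

Lemma dual_subE (X : normedModType R) (f g : dual X) x : (f - g) x = f x - g x.
Proof. by []. Qed.

(** Pair h = sum_k D_k F_k with the function g that represents its norm.  The
    D_k move to g, and by orthogonality of the signs the result is the average
    pairing of sum_k eps_k D_k g with sum_k eps_k F_k.  The first factor is
    controlled by UMD^+ and |E_N g - E_0 g|, whose q-th moment is at most 2^(q+1)
    times that of g; since 2^(q+1) <= 4^q, this gives the constant 4b. *)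
Lemma finite_umd_plus_dual (X : normedModType R) (p q b : R) :
  1 < p -> 1 < q -> p^-1 + q^-1 = 1 -> 0 < b -> finite_umd_plus (dual X) q b ->
  forall (Z K : finType) (w : Z -> R) (pi : nat -> Z -> K) N
    (F : 'I_N -> Z -> X) (h : Z -> X),
  (forall z, 0 <= w z) -> \sum_z w z = 1 -> refining pi ->
  (forall z, w z != 0 -> h z = \sum_(k < N) condexp_diff w pi k (F k) z) ->
  \sum_z w z * `|h z| `^ p <= (4 * b) `^ p *
    (2 ^- N * \sum_(e : {ffun 'I_N -> bool}) \sum_z w z *
       `|\sum_(k < N) (-1) ^+ e k *: F k z| `^ p).
Proof.
move=> p1 q1 pq b0 umd Z K w pi N F h w0 w1 rpi hE.
have p0 : 0 < p by exact: lt_trans p1.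
have q0 : 0 < q by exact: lt_trans q1.
have qp : q^-1 + p^-1 = 1 by rewrite addrC.
have [g gP] := dual_function h p0 q0 pq.
set S := leLHS; set Q := 2 ^- N * _.
(* The weight C in Young's inequality, which makes the first factor contribute
   exactly a fraction 1/q of S. *)
pose C := 4 * b; have C0 : 0 < C by rewrite mulr_gt0.
pose A (e : {ffun 'I_N -> bool}) z :=
  \sum_(k < N) (-1) ^+ e k *: condexp_diff w pi k g z.
pose B (e : {ffun 'I_N -> bool}) z := \sum_(k < N) (-1) ^+ e k *: F k z.
have SE : S = 2 ^- N * \sum_e \sum_z w z * A e z (B e z).
  transitivity (\sum_z \sum_(k < N) w z * g z (condexp_diff w pi k (F k) z)).
    apply: eq_bigr => z _; rewrite -mulr_sumr.
    have [->|wz] := eqVneq (w z) 0; first by rewrite !mul0r.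
    by rewrite -(gP z).2 (hE _ wz) linear_sum.
  rewrite exchange_big [in RHS]exchange_big/= mulr_sumr.
  transitivity (\sum_(k < N) \sum_z w z * condexp_diff w pi k g z (F k z)).
    apply: eq_bigr => k _.
    have adj l : \sum_z w z * g z (condexp w (pi l) (F k) z) =
        \sum_z w z * (condexp w (pi l) g z) (F k z).
      apply/esym; apply: (@condexp_adjoint _ _ w _ (pi l) (dual X) X R^o
        (fun (f : dual X) x => f x)) => y; first by [].
      exact: dual_linear.
    under eq_bigr do rewrite /condexp_diff linearB/= mulrBr.
    rewrite sumrB !adj -sumrB; apply: eq_bigr => z _.
    by rewrite /condexp_diff dual_subE mulrBr.
  rewrite exchange_big; apply: eq_bigr => z _; rewrite -!mulr_sumr mulrCA.
  congr (_ * _).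
  have Bl : forall y : X, scalar (fun f : dual X => f y) by [].
  have Br (f : dual X) : scalar f by exact: dual_linear.
  exact: (esym (@rademacher_orthogonality R N (dual X) X
    (fun (f : dual X) x => f x) (fun k => condexp_diff w pi k g z)
    (fun k => F k z) Bl Br)).
have AS : 2 ^- N * \sum_e \sum_z w z * `|A e z| `^ q <= C `^ q * S.
  apply: (le_trans (umd _ _ _ _ _ _ w0 w1 rpi)).
  have gS : \sum_z w z * `|g z| `^ q <= S.
    by apply: ler_sum => z _; rewrite ler_wpM2l//; case: (gP z).
  have cS k : \sum_z w z * `|condexp w (pi k) g z| `^ q <= S.
    exact: (le_trans (condexp_contraction w0 _ _ p0 q0 pq) gS).
  rewrite /C (mulrC 4) powRM ?(ltW b0)// -mulrA ler_wpM2l ?powR_ge0//.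
  apply: (@le_trans _ _ (2 `^ q * (S + S))).
    apply: (le_trans _ (ler_wpM2l (powR_ge0 _ _) (lerD (cS N) (cS 0%N)))).
    rewrite -big_split mulr_sumr/=; apply: ler_sum => z _.
    by rewrite -mulrDr mulrCA ler_wpM2l// ler_powR_normB.
  rewrite -mulr2n -(mulr_natl S) mulrA ler_wpM2r//.
    by apply: sumr_ge0 => z _; rewrite mulr_ge0// powR_ge0.
  rewrite (_ : 4 = 2 * 2); last by lra.
  rewrite powRM// ler_wpM2l ?powR_ge0//.
  by rewrite -{1}[2](powRr1)// ler_powR ?ltW//; lra.
have pt e z : A e z (B e z) <=
    C `^ (- q) * q^-1 * `|A e z| `^ q + C `^ p * p^-1 * `|B e z| `^ p.
  apply: (le_trans (ler_norm _)); apply: (le_trans (ler_dual_norm _ _)).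
  have -> : `|A e z| * `|B e z| = (C^-1 * `|A e z|) * (C * `|B e z|).
    by rewrite mulrACA mulVf ?gt_eqF// mul1r.
  have CV0 : 0 <= C^-1 by rewrite invr_ge0 ltW.
  apply: (le_trans (conjugate_powR (mulr_ge0 CV0 (normr_ge0 _))
    (mulr_ge0 (ltW C0) (normr_ge0 _)) q0 p0 qp)).
  rewrite (powRM _ CV0)// (powRM _ (ltW C0))// -(powR_inv1 (ltW C0)).
  by rewrite -powRrM mulN1r mulrAC [X in _ + X]mulrAC.
have : S <= q^-1 * S + p^-1 * (C `^ p * Q).
  apply: (@le_trans _ _ (C `^ (- q) * q^-1 *
      (2 ^- N * \sum_e \sum_z w z * `|A e z| `^ q) + C `^ p * p^-1 * Q)).
    rewrite {1}SE /Q !(mulrCA _ (2 ^- N)) -mulrDr ler_wpM2l ?invr_ge0 ?exprn_ge0//.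
    rewrite !mulr_sumr -big_split/=; apply: ler_sum => e _.
    rewrite !mulr_sumr -big_split/=; apply: ler_sum => z _.
    by rewrite !(mulrCA _ (w z)) -mulrDr ler_wpM2l.
  rewrite (mulrC _ p^-1) -(mulrA p^-1) lerD2r.
  apply: (le_trans (ler_wpM2l _ AS)).
    by rewrite mulr_ge0 ?powR_ge0 ?invr_ge0 ?(ltW q0).
  by rewrite mulrACA powRN mulVf ?mul1r// gt_eqF// powR_gt0.
exact: young_absorb p0 pq.
Qed.

End finite_umd.

Arguments condexp_diff : simpl never.

Section finite_umd_minus_stein.
Context {R : realType} {X : normedModType R}.
Variables p q b : R.
Hypotheses (p1 : 1 < p) (q1 : 1 < q) (pq : p^-1 + q^-1 = 1) (b0 : 0 < b).
Hypothesis umd : finite_umd_plus (dual X) q b.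

Section on_a_finite_set.
Context {W K : finType} (w : W -> R) (pi : nat -> W -> K).
Hypotheses (w0 : forall z, 0 <= w z) (w1 : \sum_z w z = 1).
Hypothesis rpi : refining pi.

(** The D_k are projections almost everywhere, so martingale differences satisfy
    D_k (D_k f) = D_k f and can serve as the F_k of the dual inequality. *)
Lemma finite_umd_minus N (f : W -> X) :
  \sum_z w z * `|condexp w (pi N) f z - condexp w (pi 0) f z| `^ p <=
  (4 * b) `^ p *
    (2 ^- N * \sum_(e : {ffun 'I_N -> bool}) \sum_z w z *
       `|\sum_(k < N) (-1) ^+ e k *: condexp_diff w pi k f z| `^ p).
Proof.
apply: (finite_umd_plus_dual p1 q1 pq b0 umd
  (F := fun k : 'I_N => condexp_diff w pi k f) w0 w1 rpi) => z wz.
rewrite -(telescope_sumr (fun k => condexp w (pi k) f z)) ?big_mkord//.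
apply: eq_bigr => k _; rewrite {1}/condexp_diff 2!condexpB.
have keep i j : (i <= j)%N ->
    condexp w (pi j) (condexp w (pi i) f) z = condexp w (pi i) f z.
  by move=> ij; apply: condexp_id => // y /(rpi ij) /eq_condexp.
rewrite (keep k.+1 k.+1)// (keep k k.+1)// (keep k k)// (condexp_tower w0); last exact: rpi.
by rewrite subrr subr0.
Qed.

(** On a cell that is a product, averaging a product of functions factors. *)
Lemma condexp_tensor (D L : finType) (P : pred D) (rho : D * W -> L) (c : R) i
    (phi : D -> R) (f : W -> X) d v : c != 0 -> P d ->
  (forall z, (rho z == rho (d, v)) = P z.1 && (pi i z.2 == pi i v)) ->
  condexp (fun z => c * w z.2) rho (fun z => phi z.1 *: f z.2) (d, v) =
  (#|P|%:R^-1 * \sum_(d' | P d') phi d') *: condexp w (pi i) f v.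
Proof.
move=> c0 Pd rhoE; rewrite /condexp /class_weight !(eq_bigl _ _ rhoE).
rewrite -(pair_big P (fun u => pi i u == pi i v) (fun _ u => c * w u))/=.
rewrite -(pair_big P (fun u => pi i u == pi i v)
  (fun d' u => (c * w u) *: (phi d' *: f u)))/=.
rewrite sumr_const -mulr_sumr -(mulr_natl (c * _)).
have -> : \sum_(d' | P d') \sum_(u | pi i u == pi i v) (c * w u) *: (phi d' *: f u)
    = (c * \sum_(d' | P d') phi d') *: \sum_(u | pi i u == pi i v) w u *: f u.
  rewrite mulr_sumr scaler_suml; apply: eq_bigr => d' _.
  rewrite scaler_sumr; apply: eq_bigr => u _.
  by rewrite !scalerA mulrAC.
rewrite !scalerA; congr (_ *: _).
rewrite !invfM -[LHS]mulrA -[RHS]mulrA; congr (_ * _).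
by rewrite mulrACA mulVf// mul1r mulrC.
Qed.

(** On the product of the cube with [W], let level 2i see the signs before i and
    the i-th partition, and level 2i+1 see in addition the i-th sign.  Averaging
    delta_i f_i over level 2i gives 0, by flipping the i-th sign, and over level
    2i+1 it gives delta_i E_i f_i; hence D_(2i) (delta_i f_i) = delta_i E_i f_i, and
    the dual UMD^+ inequality compares the two randomized sums.  The extra signs of
    that inequality are absorbed by a change of variables in delta. *)
Lemma finite_stein n (f : 'I_n -> W -> X) :
  2 ^- n * \sum_(e : {ffun 'I_n -> bool}) \sum_v w v *
    `|\sum_(i < n) (-1) ^+ e i *: condexp w (pi i) (f i) v| `^ p <=
  (4 * b) `^ p * (2 ^- n * \sum_(e : {ffun 'I_n -> bool}) \sum_v w v *
    `|\sum_(i < n) (-1) ^+ e i *: f i v| `^ p).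
Proof.
pose D := {ffun 'I_n -> bool}.
pose wZ (z : D * W) := 2 ^- n * w z.2.
pose L := ({ffun 'I_n -> option bool} * {ffun 'I_n -> option K})%type.
(* The second component keeps all the partitions i with 2i <= k, not only the last,
   so that the levels are visibly refining and n = 0 needs no special treatment. *)
pose rho k (z : D * W) : L :=
  ([ffun i : 'I_n => if (i.*2 < k)%N then Some (z.1 i) else None],
   [ffun i : 'I_n => if (i.*2 <= k)%N then Some (pi i z.2) else None]).
(* F_(2i) = delta_i f_i and F_(2i+1) = 0. *)
pose F (k : 'I_(n.*2)) (z : D * W) :=
  \sum_(i < n | i.*2 == k) (-1) ^+ z.1 i *: f i z.2.
pose h (z : D * W) := \sum_(i < n) (-1) ^+ z.1 i *: condexp w (pi i) (f i) z.2.
have c0 : 2 ^- n != 0 :> R by rewrite invr_eq0 expf_neq0.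
have wZ0 z : 0 <= wZ z by rewrite mulr_ge0// invr_ge0 exprn_ge0.
have sumZ (G : D * W -> R) : \sum_z wZ z * G z =
    2 ^- n * \sum_d \sum_v w v * G (d, v).
  rewrite mulr_sumr (eq_bigr (fun z => wZ (z.1, z.2) * G (z.1, z.2))) => [|[]//].
  rewrite -(pair_bigA _ (fun d v => wZ (d, v) * G (d, v)))/=.
  apply: eq_bigr => d _; rewrite mulr_sumr; apply: eq_bigr => v _.
    by rewrite mulrA.
have wZ1 : \sum_z wZ z = 1.
  have := sumZ (fun=> 1); under eq_bigr do rewrite mulr1.
  move=> ->; under eq_bigr do under eq_bigr do rewrite mulr1.
  rewrite w1 sumr_const card_ffun card_bool card_ord -natrX mulVf//.
have rrho : refining rho.
  move=> i j ij x y [/ffunP E1 /ffunP E2]; congr (_, _); apply/ffunP => k.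
    rewrite !ffunE; case: ifP => // ki.
    by have := E1 k; rewrite !ffunE (leq_trans ki ij).
  rewrite !ffunE; case: ifP => // ki.
  by have := E2 k; rewrite !ffunE (leq_trans ki ij).
pose agree k (d d' : D) := [forall j : 'I_n, (j.*2 < k)%N ==> (d' j == d j)].
have rhoE k (i : 'I_n) z d v : (i.*2 <= k <= i.*2.+1)%N ->
    (rho k z == rho k (d, v)) =
    agree k d z.1 && (pi i z.2 == pi i v).
  move=> /andP[ik ki]; rewrite /rho -pair_eqE/=; congr (_ && _).
    apply/eqP/forallP => [/ffunP E j|E].
      by have := E j; rewrite !ffunE; case: ifP => //= _ [->].
    by apply/ffunP => j; rewrite !ffunE; have := E j; case: ifP => //= _ /eqP ->.
  apply/eqP/eqP => [/ffunP/(_ i)|E]; first by rewrite !ffunE ik => -[].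
  apply/ffunP => j; rewrite !ffunE; case: ifP => // jk; congr Some.
  apply: rpi E.
  by have := half_leq (leq_trans jk ki); rewrite doubleK /= uphalf_double.
have evP (i : 'I_n) : (i.*2 < n.*2)%N by rewrite ltn_double.
pose ev i : 'I_(n.*2) := Ordinal (evP i).
have sum_ev (Y : lmodType R) (G : 'I_(n.*2) -> 'I_n -> Y) :
    \sum_(k < n.*2) \sum_(i < n | i.*2 == k) G k i = \sum_(i < n) G (ev i) i.
  rewrite (exchange_big_dep predT)//=; apply: eq_bigr => i _.
  by rewrite (big_pred1 (ev i))// => k; rewrite eq_sym.
have DF i d v : condexp_diff wZ rho (ev i)
      (fun z => (-1) ^+ z.1 i *: f i z.2) (d, v) =
    (-1) ^+ d i *: condexp w (pi i) (f i) v.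
  have Pd k : agree k d d.
    by apply/forallP => j; rewrite eqxx implybT.
  have T k (ik : (i.*2 <= k <= i.*2.+1)%N) :=
    @condexp_tensor _ _ (agree k d) (rho k) _ i (fun d : D => (-1) ^+ d i)
      (f i) d v c0 (Pd k) (fun z => rhoE k i z d v ik).
  rewrite /condexp_diff [condexp _ _ _ _ in X in X - _]T; last first.
    by rewrite leqnSn leqnn.
  rewrite [condexp _ (rho (ev i)) _ _]T; last by rewrite leqnn leqnSn.
  rewrite [X in _ - (_ * X) *: _](@sum_flip_sign _ _ i R^o); first last.
  - by move=> e; rewrite signr_flip.
  - move=> e; apply: eq_forallb => j; rewrite ffunE.
    by have [->|//] := eqVneq j i; rewrite /= ltnn.
  rewrite mulr0 scale0r subr0; congr (_ *: _).
  rewrite (eq_bigr (fun=> (-1) ^+ d i)) => [|e /forallP/(_ i)]; last first.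
    by rewrite ltnSn => /eqP ->.
  rewrite sumr_const -(mulr_natl (_ ^+ _)) mulKf// pnatr_eq0 -lt0n.
  by apply/card_gt0P; exists d; exact: Pd.
have hE z : wZ z != 0 -> h z = \sum_(k < n.*2) condexp_diff wZ rho k (F k) z.
  case: z => d v _; rewrite /h /=.
  rewrite (eq_bigr _ (fun i _ => esym (DF i d v))).
  rewrite -(sum_ev _ (fun k i => condexp_diff wZ rho k
    (fun z => (-1) ^+ z.1 i *: f i z.2) (d, v))).
  by apply: eq_bigr => k _; rewrite /condexp_diff /F !condexp_sum sumrB.
have := finite_umd_plus_dual p1 q1 pq b0 umd wZ0 wZ1 rrho hE.
rewrite sumZ => /le_trans; apply; rewrite ler_wpM2l ?powR_ge0//.
rewrite (eq_bigr (fun=> 2 ^- n * \sum_(e : D) \sum_v w v *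
    `|\sum_(i < n) (-1) ^+ e i *: f i v| `^ p)) => [|eps _].
  rewrite sumr_const card_ffun card_bool card_ord.
  by rewrite -(mulr_natl (_ * _)) mulrA natrX mulVf ?mul1r// expf_neq0.
rewrite sumZ; congr (_ * _).
(* For fixed eps, multiplying delta by eps is a bijection of the cube. *)
pose tw (d : D) : D := [ffun i => eps (ev i) (+) d i].
have twK : involutive tw.
  by move=> d; apply/ffunP => i; rewrite !ffunE addbA addbb.
rewrite [RHS](reindex_inj (inv_inj twK)); apply: eq_bigr => d _.
apply: eq_bigr => v _; congr (_ * `|_| `^ _).
rewrite (eq_bigr _ (fun i _ => scaler_sumr _ _ _ _)).
rewrite (sum_ev _ (fun k i => (-1) ^+ eps k *: ((-1) ^+ d i *: f i v))).
by apply: eq_bigr => i _; rewrite scalerA ffunE signr_addb.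
Qed.

End on_a_finite_set.
End finite_umd_minus_stein.

(** * Finitely coded functions on a probability space *)

Section coded_functions.
Local Open Scope classical_set_scope.
Context {R : realType} {d} {T : measurableType d} (P : probability T R).
Context {Z : finType} (c : T -> Z).
Hypothesis mc : forall z, measurable (c @^-1` [set z]).

Definition law z : R := fine (P (c @^-1` [set z])).

Lemma law_ge0 z : 0 <= law z. Proof. exact: fine_ge0. Qed.

Lemma measurable_coded (B : set Z) : measurable (c @^-1` B).
Proof.
rewrite -[B]image_id -bigcup_imset1 preimage_bigcup.
by apply: fin_bigcup_measurable.
Qed.

Lemma range_comp_finite (Y : Type) (psi : Z -> Y) : finite_set (range (psi \o c)).
Proof.
by apply: (@sub_finite_set _ _ (psi @` [set: Z])) => [_ [w _ <-]|];
  [exists (c w) | exact: finite_image].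
Qed.

Definition coded_fimfun (Y : Type) (psi : Z -> Y) : {fimfun T >-> Y} :=
  HB.pack (psi \o c) (FiniteImage.Build T Y (psi \o c) (range_comp_finite psi)).

Lemma integral_coded (A : set T) (psi : Z -> R) : measurable A ->
  (forall z, 0 <= psi z) ->
  (\int[P]_(w in A) (psi (c w))%:E =
   (\sum_z fine (P (A `&` c @^-1` [set z])) * psi z)%:E)%E.
Proof.
move=> mA psi0.
transitivity (\int[P]_(w in A)
    (\sum_(z <- index_enum Z) ((psi z)%:E * (\1_(c @^-1` [set z]) w)%:E)))%E.
  apply: eq_integral => w _; rewrite (bigD1 (c w))//= indicE mem_set//= mule1.
  rewrite big1 ?adde0// => z zc; rewrite indicE memNset ?mule0//=.
  by apply/eqP; rewrite eq_sym.
rewrite ge0_integral_sum//; last first.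
- by move=> z w _; rewrite mule_ge0 ?lee_fin.
- move=> z; apply: emeasurable_funM => //; apply/measurable_EFinP.
  by apply: measurable_indic.
rewrite -sumEFin; apply: eq_bigr => z _.
rewrite ge0_integralZl_EFin//; last first.
  by apply/measurable_EFinP; apply: measurable_indic.
rewrite integral_indic// setIC EFinM muleC fineK// fin_num_measure//.
exact: measurableI.
Qed.

Lemma integral_codedT (psi : Z -> R) : (forall z, 0 <= psi z) ->
  (\int[P]_w (psi (c w))%:E = (\sum_z law z * psi z)%:E)%E.
Proof.
move=> psi0; rewrite integral_coded//; congr _%:E.
by apply: eq_bigr => z _; rewrite setTI.
Qed.

Lemma sum_law : \sum_z law z = 1.
Proof.
have := @integral_codedT (fun=> 1) (fun=> ler01).
rewrite integral_cst// mul1e [X in X = _]probability_setT => -[->].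
by apply: eq_bigr => z _; rewrite mulr1.
Qed.

Section vector_valued.
Context {Y : normedModType R}.
Implicit Types psi : Z -> Y.

Lemma simple_integral_coded (A : set T) (s : {fimfun T >-> Y}) psi :
  measurable A -> (forall w, s w = psi (c w)) ->
  simple_integral P A s = \sum_z fine (P (A `&` c @^-1` [set z])) *: psi z.
Proof.
move=> mA sE; rewrite /simple_integral fsbig_finite//=.
have PE y : fine (P (A `&` s @^-1` [set y])) =
    \sum_(z | psi z == y) fine (P (A `&` c @^-1` [set z])).
  have := @integral_coded A (fun z => (psi z == y)%:R) mA (fun _ => ler0n _ _).
  have -> : (\int[P]_(w in A) ((psi (c w) == y)%:R)%:E =
      \int[P]_(w in A) (\1_(s @^-1` [set y]) w)%:E)%E.
    apply: eq_integral => w _; rewrite indicE; congr ((_ : bool)%:R%:E).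
    by apply/eqP/idP => [E|/set_mem/=]; rewrite ?sE//; apply/mem_set; rewrite /= sE.
  have my : measurable (s @^-1` [set y]).
    rewrite (_ : _ @^-1` _ = c @^-1` [set z | psi z = y]).
      exact: measurable_coded.
    by apply/seteqP; split => w /=; rewrite sE.
  rewrite integral_indic// setIC => ->/=; rewrite [RHS]big_mkcond/=.
  by apply: eq_bigr => z _; case: ifP => _; rewrite ?mulr1 ?mulr0.
under eq_bigr do rewrite PE scaler_suml.
rewrite (exchange_big_dep predT)//=; apply: eq_bigr => z _.
rewrite (eq_bigr (fun=> fine (P (A `&` c @^-1` [set z])) *: psi z)); last first.
  by move=> y /eqP ->.
have [zr|zr] := boolP (psi z \in fset_set (range s)).
  rewrite big_mkcond (bigD1_seq _ zr (fset_uniq _))/= eqxx big1 ?addr0// => y.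
  by rewrite eq_sym => /negbTE ->.
have -> : c @^-1` [set z] = set0.
  rewrite -subset0 => w /= cw; move: zr; rewrite in_fset_set// notin_setE.
  by apply; exists w => //; rewrite sE cw.
by rewrite setI0 measure0 scale0r big1.
Qed.

Lemma strongly_measurable_coded (G : set_system T) psi :
  (forall y, G ((psi \o c) @^-1` [set y])) -> strongly_measurable G (psi \o c).
Proof.
move=> Gpsi; exists (fun=> coded_fimfun psi); split => [_ y|w]; first exact: Gpsi.
exact: cvg_cst.
Qed.

Lemma strongly_measurable_coded_measurable psi :
  strongly_measurable d.-measurable (psi \o c).
Proof.
apply: strongly_measurable_coded => y.
exact: (measurable_coded [set z | psi z = y]).
Qed.

Lemma has_bochner_integral_coded (A : set T) psi : measurable A ->
  has_bochner_integral P A (psi \o c)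
    (\sum_z fine (P (A `&` c @^-1` [set z])) *: psi z).
Proof.
move=> mA; split; first exact: strongly_measurable_coded_measurable.
exists (fun=> coded_fimfun psi); split => [_ y||].
- exact: (measurable_coded [set z | psi z = y]).
- apply: cvg_near_cst; apply: nearW => k; apply: integral0_eq => w _.
  by rewrite /= subrr normr0.
- apply: cvg_near_cst; apply: nearW => k.
  exact: (@simple_integral_coded A (coded_fimfun psi) psi).
Qed.

Lemma Lp_norm_powR (p : R) (f : T -> Y) : p != 0 ->
  (Lp_norm P p f `^ p = \int[P]_w (`|f w| `^ p)%:E)%E.
Proof.
move=> p0; rewrite /Lp_norm (powR_Lnorm P _ p0).
by under eq_integral do rewrite [X in (X `^ _)%E]gee0_abs ?lee_fin// poweR_EFin.
Qed.

Lemma Lp_norm_coded_powR (p : R) psi : p != 0 ->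
  (Lp_norm P p (psi \o c) `^ p = (\sum_z law z * `|psi z| `^ p)%:E)%E.
Proof.
move=> p0; rewrite Lp_norm_powR// -integral_codedT// => z; exact: powR_ge0.
Qed.

Lemma Lp_norm_coded (p : R) psi : p != 0 ->
  Lp_norm P p (psi \o c) = ((\sum_z law z * `|psi z| `^ p) `^ p^-1)%:E.
Proof.
move=> p0; rewrite -poweR_EFin -Lp_norm_coded_powR// -poweRrM mulfV// poweRe1//.
exact: Lnorm_ge0.
Qed.

Lemma in_Lp_coded (p : R) psi : p != 0 -> in_Lp P p (psi \o c).
Proof.
move=> p0; split; first exact: strongly_measurable_coded_measurable.
by rewrite Lp_norm_coded// ltry.
Qed.

Lemma cube_average_coded (p : R) n (psi : 'I_n -> Z -> Y) : p != 0 ->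
  cube_average P p (fun i => psi i \o c) =
  ((2 ^- n * \sum_(e : {ffun 'I_n -> bool}) \sum_z law z *
      `|\sum_(i < n) (-1) ^+ e i *: psi i z| `^ p) `^ p^-1)%:E.
Proof.
move=> p0; rewrite /cube_average -poweR_EFin EFinM -sumEFin; congr ((_ * _) `^ _)%E.
apply: eq_bigr => e _.
by rewrite -(Lp_norm_coded_powR (fun z => \sum_(i < n) (-1) ^+ e i *: psi i z)).
Qed.

End vector_valued.
End coded_functions.

(** * Martingales of finitely coded functions *)

Section coded_martingales.
Local Open Scope classical_set_scope.
Context {R : realType} {d} {T : measurableType d} (P : probability T R).
Context {Z K : finType} (c : T -> Z) (pi : nat -> Z -> K).
Hypothesis mc : forall z, measurable (c @^-1` [set z]).
Hypothesis rpi : refining pi.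

Definition coded_sigma k : set_system T :=
  [set A | exists B : set K, A = (pi k \o c) @^-1` B].

Lemma filtration_coded n : filtration (fun i : 'I_n => coded_sigma i).
Proof.
split=> [i|i j ij A [B ->]].
  split=> [|A [B ->]]; last exact: (measurable_coded mc (pi i @^-1` B)).
  split.
  - by exists set0; rewrite preimage_set0.
  - by move=> A [B ->]; exists (~` B); rewrite setTD preimage_setC.
  - move=> A /choice[B AB]; exists (\bigcup_k B k).
    by rewrite preimage_bigcup; apply: eq_bigcupr => k _; rewrite AB.
exists [set k | exists2 z, pi j z = k & B (pi i z)].
apply/seteqP; split=> [w Bw|w [z jz Bz]] /=; first by exists (c w).
by rewrite -(rpi ij jz).
Qed.

Lemma martingale_coded n (Y : normedModType R) (g : Z -> Y) :
  martingale P (fun i : 'I_n => coded_sigma i)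
    (fun i : 'I_n => condexp (law P c) (pi i) g \o c).
Proof.
have smE (i : 'I_n) : strongly_measurable (coded_sigma i)
    (condexp (law P c) (pi i) g \o c).
  apply: strongly_measurable_coded => y.
  exists [set k | exists2 z, pi i z = k & condexp (law P c) (pi i) g z = y].
  apply/seteqP; split=> [w /= wy|w [z iz zy]] /=; first by exists (c w).
  by rewrite -zy; exact: eq_condexp.
split=> // i j ij; split=> // A [B AB].
have mA : measurable A by rewrite AB; exact: (measurable_coded mc (pi i @^-1` B)).
exists (\sum_z fine (P (A `&` c @^-1` [set z])) *: condexp (law P c) (pi j) g z).
split; first exact: has_bochner_integral_coded.
suff -> : \sum_z fine (P (A `&` c @^-1` [set z])) *: condexp (law P c) (pi j) g z
    = \sum_z fine (P (A `&` c @^-1` [set z])) *: condexp (law P c) (pi i) g z.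
  exact: has_bochner_integral_coded.
have PE z : fine (P (A `&` c @^-1` [set z])) = law P c z * `[< B (pi i z) >]%:R.
  rewrite AB; case: asboolP => Bz; rewrite ?mulr1 ?mulr0.
    by rewrite setIidr// => w /= ->.
  rewrite (_ : _ `&` _ = set0) ?measure0//.
  by rewrite -subset0 => w /= [+ wz]; rewrite wz.
under eq_bigr do rewrite PE -scalerA.
under [RHS]eq_bigr do rewrite PE -scalerA.
rewrite !(sum_condexp (law_ge0 P c) (phi := fun z => `[< B (pi i z) >]%:R))//.
  by move=> x y ->.
by move=> x y /(rpi ij) ->.
Qed.

End coded_martingales.

Section discrete_law.
Local Open Scope classical_set_scope.
Context {R : realType} {Z : finType} (w : Z -> R) (z0 : Z).
Hypotheses (w0 : forall z, 0 <= w z) (w1 : \sum_z w z = 1).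

Definition enum_code (k : nat) : Z := nth z0 (enum Z) k.

(** The finite UMD^+ inequality is read off on the natural numbers, where every set
    is measurable: the point k carries the weight of the k-th element of [Z]. *)
Definition weighted_dirac (k : nat) : {measure set nat -> \bar R} :=
  mscale (NngNum (w0 (enum_code k))) (dirac k).

Definition discrete_law : set nat -> \bar R := msum weighted_dirac #|Z|.

HB.instance Definition _ := Measure.on discrete_law.

Lemma discrete_lawE (A : set nat) :
  discrete_law A = (\sum_(k < #|Z|) w (enum_code k) * (\1_A (k : nat)))%:E.
Proof.
rewrite -sumEFin; apply: eq_bigr => k _.
by rewrite /weighted_dirac/= /mscale/= diracE indicE.
Qed.

Lemma sum_enum_code (F : Z -> R) : \sum_(k < #|Z|) F (enum_code k) = \sum_z F z.
Proof.
rewrite -(big_mkord xpredT (fun k => F (enum_code k))) -big_enum/=.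
by rewrite (big_nth z0) cardE.
Qed.

Lemma discrete_law_setT : discrete_law setT = 1%E.
Proof.
rewrite discrete_lawE; congr _%:E.
rewrite -[RHS]w1 -sum_enum_code; apply: eq_bigr => k _.
by rewrite indicT mulr1.
Qed.

HB.instance Definition _ :=
  Measure_isProbability.Build _ _ _ discrete_law discrete_law_setT.

Definition discrete_probability : probability nat R := discrete_law.

Lemma law_discrete_probability : law discrete_probability enum_code = w.
Proof.
apply/funext => z; rewrite /law/= discrete_lawE/=.
rewrite (eq_bigr (fun k : 'I_#|Z| => w (enum_code k) * (enum_code k == z)%:R)).
  rewrite (sum_enum_code (fun u => w u * (u == z)%:R)) (bigD1 z)//= eqxx mulr1.
  by rewrite big1 ?addr0// => u /negbTE ->; rewrite mulr0.
move=> k _; rewrite indicE; congr (_ * (_ : bool)%:R).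
by apply/idP/eqP => [/set_mem//|E]; apply/mem_set.
Qed.

End discrete_law.

Lemma weights_inhabited {R : realType} (Z : finType) (w : Z -> R) :
  \sum_z w z = 1 -> inhabited Z.
Proof.
move=> w1; apply: contrapT => Z0; have : \sum_z w z = 0.
  by rewrite big1// => z; case: Z0; exact: (inhabits z).
by rewrite w1 => /eqP; rewrite oner_eq0.
Qed.

(** Partition averages of a function on a finite set form a martingale for the
    sigma-algebras generated by the partitions. *)
Lemma umd_plus_finite {R : realType} (Y : completeNormedModType R) (q : R) :
  umd_plus Y -> 1 < q -> exists2 b : R, 0 < b & finite_umd_plus Y q b.
Proof.
move=> umd q1; have [b b0 Yb] := umd q q1; exists b => //.
move=> Z K w pi N g w0 w1 rpi.
have q0 : 0 < q by exact: lt_trans q1.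
have qN0 : q != 0 by rewrite gt_eqF.
have [z0] := weights_inhabited w1.
pose P := discrete_probability z0 w0 w1; pose c := enum_code z0.
have mc z : measurable (c @^-1` [set z])%classic by [].
have lawE : law P c = w by exact: law_discrete_probability.
pose M (i : 'I_N.+1) := condexp w (pi i) g \o c.
have := Yb N _ _ P (fun i => coded_sigma c pi i) M (filtration_coded mc rpi N.+1).
have mM : martingale P (fun i : 'I_N.+1 => coded_sigma c pi i) M.
  by rewrite /M -lawE; exact: martingale_coded.
move=> /(_ mM (fun i => in_Lp_coded P mc _ qN0)).
rewrite (_ : martingale_diff M = fun i => condexp_diff w pi i g \o c); last first.
  by apply/funext => i; apply/funext => k; rewrite /martingale_diff /M/=.
rewrite (_ : (M ord_max \- M ord0) =
  (fun z => condexp w (pi N) g z - condexp w (pi 0) g z) \o c)//.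
rewrite cube_average_coded// Lp_norm_coded// lawE.
rewrite -EFinM lee_fin => H.
set A := leLHS; set B := (X in _ <= _ * X).
have A0 : 0 <= A.
  rewrite mulr_ge0 ?invr_ge0 ?exprn_ge0// sumr_ge0// => e _.
  by rewrite sumr_ge0// => z _; rewrite mulr_ge0 ?powR_ge0.
have B0 : 0 <= B by rewrite sumr_ge0// => z _; rewrite mulr_ge0 ?powR_ge0.
have := @ge0_ler_powR R q (ltW q0) (A `^ q^-1) (b * B `^ q^-1).
rewrite !nnegrE powR_ge0 mulr_ge0 ?powR_ge0 ?(ltW b0)// => /(_ isT isT H).
rewrite powRM ?powR_ge0 ?(ltW b0)// -!powRrM mulVf//.
by rewrite (powRr1 A0) (powRr1 B0).
Qed.

(** * Joint coding of simple functions *)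

Section joint_coding.
Local Open Scope classical_set_scope.
Context {R : realType} {Y : normedModType R}.
Context {d} {T : measurableType d} {J : finType} (s : J -> {fimfun T >-> Y}).

(** Finitely many simple functions take finitely many joint values; a point is
    coded by the positions of these values in enumerations of the ranges. *)
Definition code_bound := (\max_(j : J) size (fset_set (range (s j))))%N.

Definition code w : {ffun J -> 'I_code_bound.+1} :=
  [ffun j => inord (index (s j w) (fset_set (range (s j))))].

Lemma code_inj j w w' : code w j = code w' j -> s j w = s j w'.
Proof.
have sr u : s j u \in (fset_set (range (s j)) : seq Y).
  by rewrite -[_ \in _]/(s j u \in fset_set _) in_fset_set//; apply/mem_set; exists u.
have bnd u : (index (s j u) (fset_set (range (s j))) < code_bound.+1)%N.
  rewrite ltnS (leq_trans (index_size _ _))//.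
  by rewrite (leq_bigmax (F := fun j => size (fset_set (range (s j)))) j).
move=> /(congr1 (@nat_of_ord _)); rewrite !ffunE !inordK// => E.
by rewrite -(nth_index 0 (sr w)) E nth_index.
Qed.

(** The value of [s j] at any point whose j-th coordinate is [i]; as it depends on
    this coordinate alone, it is visible to every partition that keeps it. *)
Definition decode j (i : 'I_code_bound.+1) : Y :=
  s j (xget point [set w | code w j = i]).

Lemma decodeK j w : s j w = decode j (code w j).
Proof.
by rewrite /decode; case: xgetP => [u _ /= uw|/(_ w)[]//]; exact: code_inj.
Qed.

Lemma sigma_algebra_cylinder (G : set_system T) (Q : pred J) v :
  sigma_algebra setT G -> (forall j, Q j -> simple_for G (s j)) ->
  G [set w | forall j, Q j -> code w j = v j].
Proof.
move=> sG Gs; set A := [set w | _].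
have GE := measurable_g_measurableTypeE sG.
have [[w0 w0A]|A0] := pselect (exists w, A w); last first.
  by rewrite (_ : A = set0) -?subset0 => [|w Aw]; [case: sG|apply: A0; exists w].
rewrite (_ : A = \bigcap_(j in [set j | Q j]) s j @^-1` [set s j w0]).
  rewrite -GE; apply: fin_bigcap_measurable => // j Qj.
  by rewrite GE; exact: Gs.
apply/seteqP; split=> [w Aw j Qj|w wA j Qj] /=.
  by apply: code_inj; rewrite Aw// w0A.
rewrite -w0A//; have := wA j Qj => /= sjw.
by rewrite !ffunE sjw.
Qed.

Lemma measurable_code v : (forall j, simple_for d.-measurable (s j)) ->
  measurable (code @^-1` [set v]).
Proof.
move=> ms; rewrite (_ : _ @^-1` _ = [set w | forall j, predT j -> code w j = v j]).
  by apply: sigma_algebra_cylinder => //; exact: sigma_algebra_measurable.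
by apply/seteqP; split=> [w /= -> //|w wv]; apply/ffunP => j; exact: wv.
Qed.

End joint_coding.

(** * Strongly measurable functions and L_p norms *)

Section lp_norms.
Local Open Scope classical_set_scope.
Context {R : realType} {Y : normedModType R}.
Context {d} {T : measurableType d}.
Implicit Types f g : T -> Y.
Local Notation smeasurable := (strongly_measurable d.-measurable).

Lemma strongly_measurable_sub (G : set_system T) f :
  G `<=` d.-measurable -> strongly_measurable G f -> smeasurable f.
Proof. by move=> GT [s [Gs sf]]; exists s; split=> // k y; exact/GT/Gs. Qed.

Lemma measurable_fun_code (J : finType) (s : J -> {fimfun T >-> Y})
    (phi : {ffun J -> 'I_(code_bound s).+1} -> R) :
  (forall j, simple_for d.-measurable (s j)) ->
  measurable_fun setT (fun w => phi (code s w)).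
Proof.
move=> ms _ B _; rewrite setTI.
exact: (measurable_coded (fun z => measurable_code z ms) (phi @^-1` B)).
Qed.

Lemma measurable_norm f : smeasurable f -> measurable_fun setT (fun w => `|f w|).
Proof.
move=> [s [ms sf]]; apply: (@measurable_fun_cvg _ _ _ _ (fun k w => `|s k w|)).
  move=> k; pose sk (_ : unit) := s k.
  rewrite (_ : (fun w => _) = (fun w => `|decode (s := sk) tt (code sk w tt)|)).
    exact: (@measurable_fun_code _ sk (fun v => `|decode tt (v tt)|) (fun=> ms k)).
  by apply/funext => w; rewrite -(decodeK sk).
by move=> w _; apply: cvg_norm; exact: sf.
Qed.

Lemma strongly_measurable_lincomb (J : finType) (a : J -> R) (f : J -> T -> Y) :
  (forall j, smeasurable (f j)) -> smeasurable (fun w => \sum_j a j *: f j w).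
Proof.
move=> /choice[s sP].
pose phi k (v : {ffun J -> 'I_(code_bound (s ^~ k)).+1}) :=
  \sum_j a j *: decode (s := s ^~ k) j (v j).
exists (fun k => coded_fimfun (code (s ^~ k)) (phi k)); split=> [k y|w].
  apply: (measurable_coded (c := code (s ^~ k)) _ [set v | phi k v = y]) => v.
  by apply: measurable_code => j; case: (sP j).
rewrite (_ : (fun k => _) = (fun k => \sum_j a j *: s j k w)); last first.
  apply/funext => k; rewrite /= /phi; apply: eq_bigr => j _.
  by rewrite -(decodeK (s ^~ k)).
apply: cvg_big => [|j _]; first exact: add_continuous.
by apply: cvgZl_tmp; case: (sP j).
Qed.

Lemma strongly_measurableB f g : smeasurable f -> smeasurable g ->
  smeasurable (fun w => f w - g w).
Proof.
move=> mf mg.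
have := @strongly_measurable_lincomb bool (fun b => (-1) ^+ b)
  (fun b => if b then g else f).
rewrite (_ : (fun w => _) = (fun w => f w - g w)); first by apply; case.
by apply/funext => w; rewrite big_bool/= expr1 expr0 scaleN1r scale1r addrC.
Qed.

Lemma strongly_measurable_signed_sum n (e : {ffun 'I_n -> bool})
    (x : 'I_n -> T -> Y) :
  (forall i, smeasurable (x i)) -> smeasurable (signed_sum e x).
Proof. by move=> mx; exact: strongly_measurable_lincomb. Qed.

Variable P : probability T R.
Variable p : R.
Hypothesis p1 : 1 < p.

Let p0 : 0 < p. Proof. exact: lt_trans p1. Qed.
Let pN0 : p != 0. Proof. by rewrite gt_eqF. Qed.

Local Notation rnorm h := (Lnorm P p%:E (EFin \o h)).

Lemma le_Lnorm (g h : T -> R) : measurable_fun setT g -> measurable_fun setT h ->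
  (forall w, `|g w| <= `|h w|) -> (rnorm g <= rnorm h)%E.
Proof.
move=> mg mh gh; rewrite unlock; apply: gt0_ler_poweR.
- by rewrite invr_ge0 ltW.
- by rewrite in_itv/= leey integral_ge0// => w _; rewrite poweR_ge0.
- by rewrite in_itv/= leey integral_ge0// => w _; rewrite poweR_ge0.
have mp (u : T -> R) : measurable_fun setT u ->
    measurable_fun setT (fun w => `|(EFin \o u) w| `^ p)%E.
  move=> mu; rewrite (_ : (fun w => _) = EFin \o (fun w => `|u w| `^ p))//.
  apply/measurable_EFinP; apply: (measurableT_comp (measurable_powR _)).
  exact: measurableT_comp.
apply: ge0_le_integral => //.
- by move=> w _; exact: poweR_ge0.
- exact: mp.
- exact: mp.
- by move=> w _; rewrite /= lee_fin ge0_ler_powR ?nnegrE// ltW.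
Qed.

Lemma Lnorm_sum (I : Type) (r : seq I) (h : I -> T -> R) :
  (forall i, measurable_fun setT (h i)) ->
  (rnorm (fun w => \sum_(i <- r) h i w)%R <= \sum_(i <- r) rnorm (h i))%E.
Proof.
move=> mh; elim: r => [|i r IH].
  rewrite big_nil (_ : EFin \o _ = cst 0%E) ?Lnorm0//.
  by apply/funext => w; rewrite /= big_nil.
rewrite big_cons (_ : (fun w => _) = h i \+ (fun w => \sum_(i <- r) h i w)).
  apply: (le_trans (minkowski_EFin _ _ _ (ltW p1))) => //.
    exact: measurable_sum.
  exact: leeD2l.
by apply/funext => w; rewrite big_cons.
Qed.

Lemma Lp_norm_ge0 f : (0 <= Lp_norm P p f)%E. Proof. exact: Lnorm_ge0. Qed.

(** Minkowski's inequality, in the form that absorbs pointwise estimates. *)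
Lemma Lp_norm_triangle (I : Type) (r : seq I) f (h : I -> T -> Y) :
  smeasurable f -> (forall i, smeasurable (h i)) ->
  (forall w, `|f w| <= \sum_(i <- r) `|h i w|) ->
  (Lp_norm P p f <= \sum_(i <- r) Lp_norm P p (h i))%E.
Proof.
move=> mf mh fh; apply: le_trans (Lnorm_sum _ _); last first.
  by move=> i; apply: measurable_norm.
apply: le_Lnorm => [||w].
- exact: measurable_norm.
- by apply: measurable_sum => i; exact: measurable_norm.
- by rewrite normr_id (le_trans (fh w))// ler_norm.
Qed.

Lemma Lp_norm_leD f g (h : T -> Y) : smeasurable f -> smeasurable g -> smeasurable h ->
  (forall w, `|f w| <= `|g w| + `|h w|) ->
  (Lp_norm P p f <= Lp_norm P p g + Lp_norm P p h)%E.
Proof.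
move=> mf mg mh fgh.
have := @Lp_norm_triangle bool [:: true; false] f (fun b => if b then g else h).
rewrite !big_cons big_nil adde0; apply => //; first by case.
by move=> w; rewrite !big_cons big_nil addr0.
Qed.

Lemma signed_sum_perturb n (e : {ffun 'I_n -> bool}) (x y : 'I_n -> T -> Y)
    (eps : R) :
  (forall i, smeasurable (x i)) -> (forall i, smeasurable (y i)) ->
  (forall i, Lp_norm P p (fun w => x i w - y i w)%R <= eps%:E)%E ->
  (Lp_norm P p (signed_sum e x) <=
   Lp_norm P p (signed_sum e y) + (n%:R * eps)%:E)%E.
Proof.
move=> mx my xy.
have mxy i : smeasurable (fun w => x i w - y i w) by exact: strongly_measurableB.
have mD := @strongly_measurable_signed_sum n e (fun i w => x i w - y i w) mxy.
apply: (le_trans (Lp_norm_leD (strongly_measurable_signed_sum e mx)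
  (strongly_measurable_signed_sum e my) mD _)).
  move=> w; apply: le_trans (ler_normD _ _); rewrite /signed_sum -big_split/=.
  by under [in leRHS]eq_bigr do rewrite -scalerDr addrC subrK.
rewrite leeD2l//.
apply: (le_trans (@Lp_norm_triangle 'I_n (index_enum _) _ _ mD mxy _)).
  move=> w; apply: (le_trans (ler_norm_sum _ _ _)); apply: ler_sum => i _.
  by rewrite normrZ normrX normrN1 expr1n mul1r.
apply: (le_trans (lee_sum _ (fun i _ => xy i))).
by rewrite sumEFin sumr_const card_ord mulr_natl.
Qed.

End lp_norms.

(** Averages over the cube are L_p norms over a finite probability space, so
    Minkowski's inequality applies to them as well. *)
Lemma finite_minkowski {R : realType} (Z : finType) (w a : Z -> R) (p t : R) :
  1 < p -> (forall z, 0 <= w z) -> \sum_z w z = 1 -> (forall z, 0 <= a z) ->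
  0 <= t ->
  (\sum_z w z * (a z + t) `^ p) `^ p^-1 <= (\sum_z w z * a z `^ p) `^ p^-1 + t.
Proof.
move=> p1 w0 w1 a0 t0.
have p0 : 0 < p by exact: lt_trans p1.
have pN0 : p != 0 by rewrite gt_eqF.
have [z0] := weights_inhabited w1.
pose P := discrete_probability z0 w0 w1; pose c := enum_code z0.
have mc z : measurable (c @^-1` [set z])%classic by [].
have lawE : law P c = w by exact: law_discrete_probability.
have msm (psi : Z -> R^o) := strongly_measurable_coded_measurable mc psi.
have := Lp_norm_leD P p1 (msm (fun z => a z + t)) (msm a) (msm (fun=> t)).
rewrite !(Lp_norm_coded P mc _ pN0) lawE -EFinD lee_fin => H.
have wt : (\sum_z w z * `|t| `^ p) `^ p^-1 = t.
  by rewrite -mulr_suml w1 mul1r -powRrM mulfV// powRr1 ger0_norm.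
rewrite wt in H.
have E1 : \sum_z w z * (a z + t) `^ p = \sum_z w z * `|(a z + t : R^o)| `^ p.
  by apply: eq_bigr => z _; rewrite ger0_norm// addr_ge0.
have E2 : \sum_z w z * a z `^ p = \sum_z w z * `|(a z : R^o)| `^ p.
  by apply: eq_bigr => z _; rewrite ger0_norm.
rewrite E1 E2; exact: (H (fun n => ler_normD _ _)).
Qed.

Lemma cube_average_perturb {R : realType} {Y : normedModType R} {d}
    {T : measurableType d} (P : probability T R) (p : R) n
    (x y : 'I_n -> T -> Y) (eps : R) :
  1 < p -> 0 <= eps ->
  (forall i, strongly_measurable d.-measurable%classic (x i)) ->
  (forall i, in_Lp P p (y i)) ->
  (forall i, Lp_norm P p (fun w => x i w - y i w)%R <= eps%:E)%E ->
  (cube_average P p x <= cube_average P p y + (n%:R * eps)%:E)%E.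
Proof.
move=> p1 eps0 mx yp xy.
have p0 : 0 < p by exact: lt_trans p1.
have my i : strongly_measurable d.-measurable%classic (y i) by case: (yp i).
have fy e : Lp_norm P p (signed_sum e y) \is a fin_num.
  rewrite ge0_fin_numE ?Lp_norm_ge0//.
  apply: (@le_lt_trans _ _ (\sum_i Lp_norm P p (y i))%E); last first.
    by apply: lte_sum_pinfty => i _; case: (yp i).
  apply: Lp_norm_triangle => //; first exact: strongly_measurable_signed_sum.
  move=> w; apply: (le_trans (ler_norm_sum _ _ _)); apply: ler_sum => i _.
  by rewrite normrZ normrX normrN1 expr1n mul1r.
pose a (e : {ffun 'I_n -> bool}) := fine (Lp_norm P p (signed_sum e y)).
have a0 e : 0 <= a e by rewrite fine_ge0// Lp_norm_ge0.
have t0 : 0 <= n%:R * eps by rewrite mulr_ge0.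
have w1 : \sum_(e : {ffun 'I_n -> bool}) (2 ^- n : R) = 1.
  rewrite sumr_const card_ffun card_bool card_ord -(mulr_natl (2 ^- n)) natrX.
  by rewrite mulfV// expf_neq0.
have w0 : 0 <= 2 ^- n :> R by rewrite invr_ge0 exprn_ge0.
have H := finite_minkowski p1 (fun=> w0) w1 a0 t0.
have -> : cube_average P p y =
    ((\sum_(e : {ffun 'I_n -> bool}) 2 ^- n * a e `^ p) `^ p^-1)%:E.
  rewrite /cube_average -poweR_EFin -mulr_sumr EFinM -sumEFin.
  congr ((_ * _) `^ _)%E; apply: eq_bigr => e _.
  by rewrite -poweR_EFin fineK.
apply: (@le_trans _ _
  ((\sum_(e : {ffun 'I_n -> bool}) 2 ^- n * (a e + n%:R * eps) `^ p) `^ p^-1)%:E);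
  last by rewrite -EFinD lee_fin.
rewrite -poweR_EFin -mulr_sumr EFinM -sumEFin /cube_average.
have c0 : (0 <= (2 ^- n : R)%:E)%E by rewrite lee_fin invr_ge0 exprn_ge0.
apply: gt0_ler_poweR.
- by rewrite invr_ge0 ltW.
- rewrite in_itv/= leey mule_ge0// sume_ge0// => e _; exact: poweR_ge0.
- by rewrite in_itv/= leey mule_ge0// sume_ge0// => e _; rewrite lee_fin powR_ge0.
rewrite lee_wpmul2l//; apply: lee_sum => e _; rewrite -poweR_EFin.
apply: gt0_ler_poweR.
- exact: ltW.
- by rewrite in_itv/= leey Lp_norm_ge0.
- by rewrite in_itv/= leey lee_fin addr_ge0.
by rewrite EFinD fineK//; exact: signed_sum_perturb.
Qed.

(** * Approximating conditional expectations by averages over finite partitions *)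

Section bochner_estimates.
Local Open Scope classical_set_scope.
Context {R : realType} {Y : normedModType R}.
Context {d} {T : measurableType d} (P : probability T R).
Implicit Types f g : T -> Y.
Local Notation smeasurable := (strongly_measurable d.-measurable).

Lemma cvge0_near_lt (a : nat -> \bar R) (e : R) : 0 < e ->
  (a k @[k --> \oo] --> 0)%E -> \forall k \near \oo, (a k < e%:E)%E.
Proof.
move=> e0 a0; apply: (a0 [set x | (x < e%:E)%E]).
apply: open_nbhs_nbhs; split; last by rewrite /= lte_fin.
exact: open_ereal_lt_ereal.
Qed.

Lemma simple_strongly_measurable (G : set_system T) (s : {fimfun T >-> Y}) :
  simple_for G s -> strongly_measurable G s.
Proof. by move=> Gs; exists (fun=> s); split=> // w; exact: cvg_cst. Qed.

Lemma measurable_dist f g : smeasurable f -> smeasurable g ->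
  measurable_fun setT (fun w => `|f w - g w|).
Proof. by move=> mf mg; exact: measurable_norm (strongly_measurableB mf mg). Qed.

Lemma simple_integral_dist (A : set T) (s t : {fimfun T >-> Y}) :
  measurable A -> simple_for d.-measurable s -> simple_for d.-measurable t ->
  (`|simple_integral P A s - simple_integral P A t|%:E <=
   \int[P]_(w in A) `|s w - t w|%:E)%E.
Proof.
move=> mA ms mt; pose st (b : bool) := if b then s else t.
have mst b : simple_for d.-measurable (st b) by case: b.
have mc z := measurable_code z mst.
pose phi (v : {ffun bool -> 'I_(code_bound st).+1}) := decode (s := st) true (v true).
pose psi (v : {ffun bool -> 'I_(code_bound st).+1}) := decode (s := st) false (v false).
have sE w : s w = phi (code st w) by exact: (decodeK st true w).
have tE w : t w = psi (code st w) by exact: (decodeK st false w).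
rewrite (simple_integral_coded P mc mA sE) (simple_integral_coded P mc mA tE).
under eq_integral do rewrite sE tE.
rewrite (integral_coded P mc (psi := fun z => `|phi z - psi z|))// lee_fin.
rewrite -sumrB; apply: (le_trans (ler_norm_sum _ _ _)); apply: ler_sum => z _.
by rewrite -scalerBr normrZ ger0_norm// fine_ge0.
Qed.

(** Through this estimate the common value v of the integrals of f and of its
    conditional expectation over a cell is compared with averages of simple
    functions. *)
Lemma has_bochner_integral_dist (A : set T) f v (s : {fimfun T >-> Y}) :
  measurable A -> simple_for d.-measurable s -> has_bochner_integral P A f v ->
  (`|simple_integral P A s - v|%:E <= \int[P]_(w in A) `|f w - s w|%:E)%E.
Proof.
move=> mA ms [mf [t [mt ft tv]]].
apply/lee_addgt0Pr => e e0; have e20 : 0 < e / 2 by rewrite divr_gt0.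
have mfA (g : T -> Y) : smeasurable g ->
    measurable_fun A (fun w => `|f w - g w|%:E).
  by move=> mg; apply/measurable_funTS/measurable_EFinP; exact: measurable_dist.
near \oo => k.
have k1 : (\int[P]_(w in A) `|f w - t k w|%:E < (e / 2)%:E)%E.
  by near: k; exact: cvge0_near_lt.
have k2 : `|v - simple_integral P A (t k)| < e / 2.
  by near: k; move/cvgrPdist_lt : tv; exact.
apply: (@le_trans _ _ (`|simple_integral P A s - simple_integral P A (t k)|%:E +
    (e / 2)%:E)%E).
  rewrite -EFinD lee_fin -(subrKA (simple_integral P A (t k))).
  by rewrite (le_trans (ler_normD _ _))// lerD2l distrC ltW.
rewrite [in leRHS](splitr e) EFinD addeA leeD2r//.
apply: (le_trans (simple_integral_dist mA ms (mt k))).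
apply: (@le_trans _ _ (\int[P]_(w in A) (`|f w - s w|%:E + `|f w - t k w|%:E))%E).
  apply: ge0_le_integral => //.
  - apply/measurable_funTS/measurable_EFinP; apply: measurable_dist.
      exact: simple_strongly_measurable.
    exact: (simple_strongly_measurable (mt k)).
  - apply: emeasurable_funD; apply: mfA; first exact: simple_strongly_measurable.
    exact: (simple_strongly_measurable (mt k)).
  - move=> w _; rewrite -EFinD lee_fin -(subrKA (f w)).
    by rewrite (le_trans (ler_normD _ _))// (distrC (s w)).
rewrite ge0_integralD//; [|by apply: mfA; exact: simple_strongly_measurable|
  by apply: mfA; exact: (simple_strongly_measurable (mt k))].
by rewrite leeD2l// ltW.
Unshelve. all: by end_near. Qed.

End bochner_estimates.

Section coded_condexp.
Local Open Scope classical_set_scope.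
Context {R : realType} {Y : normedModType R}.
Context {d} {T : measurableType d} (P : probability T R).
Context {Z K : finType} (c : T -> Z) (pi : Z -> K).
Hypothesis mc : forall z, measurable (c @^-1` [set z]).

Lemma integral_coded_mul (psi : Z -> R) (h : T -> R) :
  (forall z, 0 <= psi z) -> measurable_fun setT h -> (forall w, 0 <= h w) ->
  (\int[P]_w (psi (c w) * h w)%:E =
   \sum_z (psi z)%:E * \int[P]_(w in c @^-1` [set z]) (h w)%:E)%E.
Proof.
move=> psi0 mh h0.
have mhz z : measurable_fun setT (fun w => (h w * \1_(c @^-1` [set z]) w)%:E).
  apply/measurable_EFinP; apply: measurable_funM => //.
transitivity (\int[P]_w
    (\sum_(z <- index_enum Z) ((psi z)%:E * (h w * \1_(c @^-1` [set z]) w)%:E)))%E.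
  apply: eq_integral => w _; rewrite (bigD1 (c w))//= indicE mem_set//= mulr1.
  rewrite big1 ?adde0// => z zc; rewrite indicE memNset ?mulr0 ?mule0//=.
  by apply/eqP; rewrite eq_sym.
rewrite ge0_integral_sum//; last first.
- by move=> z w _; rewrite mule_ge0 ?lee_fin ?mulr_ge0.
- by move=> z; apply: emeasurable_funM.
apply: eq_bigr => z _; rewrite ge0_integralZl_EFin//; last first.
  by move=> w _; rewrite lee_fin mulr_ge0.
congr (_ * _)%E; rewrite [RHS]integral_mkcond; apply: eq_integral => w _.
by rewrite patchE indicE; case: ifP => wz; rewrite ?wz/= ?mulr1// mulr0.
Qed.

(** On a cell A of the partition, f and its conditional expectation have the same
    integral, so the average of [phi] over A and the constant value of [psi] on A
    differ by at most the mean of |f - phi(c)| + |Ef - psi(c)| over A.  Young's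
    inequality then gives the L_p estimate as in condexp_contraction.  The cut-off
    [Q] serves to localize to a set on which Ef is known to be bounded. *)
Lemma condexp_coded_dist (F : set_system T) (f Ef : T -> Y) (phi psi : Z -> Y)
    (Q : Z -> bool) (p q : R) :
  0 < p -> 0 < q -> p^-1 + q^-1 = 1 ->
  F `<=` d.-measurable -> (forall k, F ((pi \o c) @^-1` [set k])) ->
  is_cond_expectation P F f Ef -> strongly_measurable d.-measurable f ->
  (forall x y, pi x = pi y -> psi x = psi y) ->
  (forall x y, pi x = pi y -> Q x = Q y) ->
  (\int[P]_w (((Q (c w))%:R *
       `|condexp (law P c) pi phi (c w) - psi (c w)|) `^ p)%:E <=
   \int[P]_w (((Q (c w))%:R *
       (`|f w - phi (c w)| + `|Ef w - psi (c w)|)) `^ p)%:E)%E.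
Proof.
move=> p0 q0 pq FT Fpi [mE fE] mf psiE QE.
have qp : q^-1 + p^-1 = 1 by rewrite addrC.
have mEf := strongly_measurable_sub FT mE.
have mphi := strongly_measurable_coded_measurable mc phi.
have mpsi := strongly_measurable_coded_measurable mc psi.
pose w := law P c; have w0 : forall z, 0 <= w z := law_ge0 P c.
pose k w := `|f w - phi (c w)| + `|Ef w - psi (c w)|.
pose h x := (Q (c x))%:R * k x.
have k0 x : 0 <= k x by rewrite addr_ge0.
have mk : measurable_fun setT k.
  by apply: measurable_funD; exact: measurable_dist.
have mcfun (a : Z -> R) : measurable_fun setT (fun x => a (c x)).
  by move=> _ B _; rewrite setTI; exact: (measurable_coded mc (a @^-1` B)).
have mh : measurable_fun setT h.
  by apply: measurable_funM => //; exact: (mcfun (fun z => (Q z)%:R)).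
have h0 x : 0 <= h x by rewrite mulr_ge0.
have mhp : measurable_fun setT (fun x => h x `^ p).
  exact: (measurableT_comp (measurable_powR _)).
pose D z := (Q z)%:R * `|condexp w pi phi z - psi z|.
pose Hp := (\int[P]_x (h x `^ p)%:E)%E.
change (\int[P]_x (D (c x) `^ p)%:E <= Hp)%E.
have Hp0 : (0 <= Hp)%E by rewrite integral_ge0// => x _; rewrite lee_fin powR_ge0.
have [->|HpNy] := eqVneq Hp +oo%E; first by rewrite leey.
have Hpfin : Hp \is a fin_num by rewrite ge0_fin_numE// ltey.
pose hz z := (\int[P]_(x in c @^-1` [set z]) (h x)%:E)%E.
have hz0 z : (0 <= hz z)%E by rewrite integral_ge0// => x _; rewrite lee_fin.
have hzfin z : hz z \is a fin_num.
  rewrite ge0_fin_numE// (@le_lt_trans _ _ (\int[P]_x (1 + h x `^ p)%:E)%E)//.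
    apply: (@le_trans _ _ (\int[P]_x (h x)%:E)%E).
      apply: ge0_subset_integral => //; first exact/measurable_EFinP.
      by move=> x _; rewrite lee_fin.
    apply: ge0_le_integral => //.
    - by move=> x _; rewrite lee_fin.
    - exact/measurable_EFinP.
    - by apply/measurable_EFinP; exact: measurable_funD.
    - move=> x _; rewrite lee_fin.
      have [h1|/ltW h1] := leP (h x) 1; first by rewrite ler_wpDr ?powR_ge0.
      rewrite ler_wpDl// -{1}(powRr1 (h0 x)) ler_powR//.
      by rewrite -invf_le1// -pq lerDl invr_ge0 ltW.
  under eq_integral do rewrite EFinD.
  rewrite ge0_integralD//; [|by move=> x _; rewrite lee_fin powR_ge0|exact/measurable_EFinP].
  rewrite integral_cst// mul1e lte_add_pinfty// ?ltey//.
  by rewrite -ltey; apply: (le_lt_trans (probability_le1 P measurableT)); rewrite ltry.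
have D0 z : 0 <= D z by rewrite mulr_ge0.
have DE x y : pi x = pi y -> D x = D y.
  by move=> xy; rewrite /D (QE _ _ xy) (psiE _ _ xy) (eq_condexp _ _ xy).
(* The mean of h over the points coded by z, so that the mean of h over a cell is
   the conditional expectation of eta. *)
pose eta z : R^o := (w z)^-1 * fine (hz z).
have wPz z : (w z)%:E = P (c @^-1` [set z]) by rewrite fineK// fin_num_measure.
have weta z : w z * eta z = fine (hz z).
  rewrite /eta; have [wz|wz] := eqVneq (w z) 0; last by rewrite mulVKf.
  rewrite wz mul0r (_ : hz z = 0%E)//; apply: null_set_integral => //.
    by apply/measurable_funTS/measurable_EFinP.
  by rewrite -[LHS]wPz wz.
have cellD z : w z != 0 -> D z <= condexp w pi eta z.
  move=> wz; have W0 : class_weight w pi z != 0 by rewrite class_weight_neq0.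
  have Wp : 0 < class_weight w pi z by rewrite lt_neqAle eq_sym W0 sumr_ge0.
  have E0 : 0 <= condexp w pi eta z.
    rewrite mulr_ge0 ?invr_ge0 ?sumr_ge0// => y _.
    by rewrite mulr_ge0// mulr_ge0 ?invr_ge0 ?fine_ge0.
  rewrite /D; case Qz : (Q z); rewrite ?mul0r// mul1r.
  pose A := (pi \o c) @^-1` [set pi z].
  have FA : F A by exact: Fpi.
  have mA : measurable A by exact: FT.
  have [v [fv Ev]] := fE A FA.
  have PA y : fine (P (A `&` c @^-1` [set y])) = (pi y == pi z)%:R * w y.
    case: eqP => yz; rewrite ?mul1r ?mul0r.
      by rewrite setIidr// => x /= cx; rewrite /A/= cx.
    rewrite (_ : _ `&` _ = set0) ?measure0// -subset0 => x [].
    by rewrite /A/= => + cx; rewrite cx.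
  have SI (g : Z -> Y) : simple_integral P A (coded_fimfun c g) =
      \sum_(y | pi y == pi z) w y *: g y.
    rewrite (simple_integral_coded P mc mA (psi := g))// [RHS]big_mkcond.
    apply: eq_bigr => y _; rewrite PA.
    by case: ifP => _; rewrite ?mul1r// mul0r scale0r.
  have ms (g : Z -> Y) : simple_for d.-measurable (coded_fimfun c g).
    by move=> y; exact: (measurable_coded mc [set u | g u = y]).
  rewrite -(ler_pM2l Wp).
  have -> : class_weight w pi z * condexp w pi eta z = \sum_(y | pi y == pi z) fine (hz y).
    rewrite mulrA mulfV// mul1r; apply: eq_bigr => y _; exact: weta.
  have -> : class_weight w pi z * `|condexp w pi phi z - psi z| =
      `|simple_integral P A (coded_fimfun c phi) -
        simple_integral P A (coded_fimfun c psi)|.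
    rewrite !SI -{1}(gtr0_norm Wp) -normrZ scalerBr scalerA mulfV// scale1r.
    rewrite [X in _ = `|_ - X|](eq_bigr (fun y => w y *: psi z)) => [|y /eqP /psiE ->//].
    by rewrite -scaler_suml.
  rewrite -lee_fin.
  apply: (@le_trans _ _ (\int[P]_(x in A) `|f x - phi (c x)|%:E +
      \int[P]_(x in A) `|Ef x - psi (c x)|%:E)%E).
    have := leeD (has_bochner_integral_dist mA (ms phi) fv)
      (has_bochner_integral_dist mA (ms psi) Ev).
    apply: le_trans; rewrite -EFinD lee_fin.
    by rewrite -[X in `|X| <= _](subrKA v) (le_trans (ler_normD _ _))// lerD2l distrC.
  have mA' (g g' : T -> Y) : strongly_measurable d.-measurable g ->
      strongly_measurable d.-measurable g' ->
      measurable_fun A (fun x => `|g x - g' x|%:E).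
    by move=> mg mg'; apply/measurable_funTS/measurable_EFinP; exact: measurable_dist.
  rewrite -ge0_integralD//; [|exact: mA'|exact: mA'].
  rewrite integral_mkcond (eq_integral (fun x => ((pi (c x) == pi z)%:R * h x)%:E)).
    rewrite (@integral_coded_mul (fun y => (pi y == pi z)%:R))//.
    rewrite -sumEFin [leRHS]big_mkcond; apply: lee_sum => y _.
    by case: ifP => _; rewrite ?mul1e ?fineK// mul0e.
  move=> x _; rewrite patchE; case: ifPn => [/set_mem/= xA|xA].
    have {}xA : pi (c x) = pi z by exact: xA.
    by rewrite xA eqxx mul1r /h (QE _ _ xA) Qz mul1r EFinD.
  rewrite (_ : _ == _ = false) ?mul0r//; apply: contraNF xA => /eqP xA.
  by apply/mem_set.
have IS : (\int[P]_x ((D (c x)) `^ p)%:E)%E = (\sum_z w z * D z `^ p)%:E.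
  by rewrite (integral_codedT P mc (psi := fun z => D z `^ p))// => z; exact: powR_ge0.
rewrite IS -(fineK Hpfin) lee_fin; set S := leLHS.
have SD : S <= \sum_z D z `^ (p - 1) * fine (hz z).
  apply: (@le_trans _ _ (\sum_z w z * (D z `^ (p - 1) * condexp w pi eta z))).
    apply: ler_sum => z _; have [->|wz] := eqVneq (w z) 0; first by rewrite !mul0r.
    by rewrite ler_wpM2l// -powR_subM// ler_wpM2l ?powR_ge0// cellD.
  have := @sum_condexp _ _ w w0 _ pi R^o (fun z => D z `^ (p - 1)) eta.
  move=> -> => [|x y /DE ->//]; apply: ler_sum => z _.
  by rewrite [leLHS]mulrCA weta.
have : S <= q^-1 * S + p^-1 * fine Hp.
  apply: (le_trans SD); rewrite -lee_fin EFinD !EFinM (fineK Hpfin) -IS.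
  rewrite -sumEFin (eq_bigr (fun z => (D z `^ (p - 1))%:E * hz z)%E) => [|z _]; last first.
    by rewrite EFinM fineK.
  rewrite -(@integral_coded_mul (fun z => D z `^ (p - 1)))//; last first.
    by move=> z; exact: powR_ge0.
  have mDp (r : R) : measurable_fun setT (fun x => (D (c x) `^ r)%:E).
    by apply/measurable_EFinP; exact: (mcfun (fun z => D z `^ r)).
  rewrite -ge0_integralZl_EFin ?invr_ge0 ?(ltW q0)//; last first.
    by move=> x _; rewrite lee_fin powR_ge0.
  rewrite -ge0_integralZl_EFin ?invr_ge0 ?(ltW p0)//; last 2 first.
  - by move=> x _; rewrite lee_fin powR_ge0.
  - exact/measurable_EFinP.
  rewrite -ge0_integralD//; last 4 first.
  - by move=> x _; rewrite lee_fin mulr_ge0 ?invr_ge0 ?(ltW q0) ?powR_ge0.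
  - by apply: emeasurable_funM.
  - by move=> x _; rewrite lee_fin mulr_ge0 ?invr_ge0 ?(ltW p0) ?powR_ge0.
  - by apply: emeasurable_funM => //; exact/measurable_EFinP.
  apply: ge0_le_integral => //.
  - by move=> x _; rewrite lee_fin mulr_ge0 ?powR_ge0.
  - apply/measurable_EFinP/measurable_funM => //.
    exact: (mcfun (fun z => D z `^ (p - 1))).
  - apply/measurable_EFinP/measurable_funD.
      by apply: measurable_funM => //; exact: (mcfun (fun z => D z `^ p)).
    exact: measurable_funM.
  - move=> x _; rewrite lee_fin.
    apply: (le_trans (conjugate_powR (powR_ge0 _ _) (h0 x) q0 p0 qp)).
    by rewrite -powRrM conjugate_subM// (mulrC q^-1) (mulrC p^-1).
exact: young_absorb p0 pq.
Qed.

End coded_condexp.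

(** * Density of simple functions *)

Section density.
Local Open Scope classical_set_scope.
Context {R : realType} {Y : normedModType R}.
Context {d} {T : measurableType d} (P : probability T R).
Implicit Types (G : set_system T) (f : T -> Y) (s : nat -> {fimfun T >-> Y}).
Local Notation smeasurable := (strongly_measurable d.-measurable).

(** Unlike the set where the limit is at most N, this set is visibly in the
    sigma-algebra of the simple functions [s k]. *)
Definition bounded_part s (N : nat) : set T :=
  [set w | forall k, `|s k w| <= N%:R].

Definition truncation (B : set T) (t : {fimfun T >-> Y}) w : Y :=
  if w \in B then t w else 0.

Lemma range_truncation B t : finite_set (range (truncation B t)).
Proof.
apply: (@sub_finite_set _ _ (range t `|` [set 0])).
  move=> _ [w _ <-]; rewrite /truncation; case: ifP => _; last by right.
  by left; exists w.
by rewrite finite_setU; split; [exact: fimfunP|exact: finite_set1].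
Qed.

Definition truncated (B : set T) (t : {fimfun T >-> Y}) : {fimfun T >-> Y} :=
  HB.pack (truncation B t) (FiniteImage.Build T Y _ (range_truncation B t)).

Section sub_sigma_algebra.
Variable G : set_system T.
Hypothesis sG : sigma_algebra setT G.

Lemma sigma_preimage (t : {fimfun T >-> Y}) (B : set Y) :
  simple_for G t -> G (t @^-1` B).
Proof.
have GE := measurable_g_measurableTypeE sG.
move=> Gt; rewrite (_ : _ @^-1` _ = \bigcup_(y in range t `&` B) t @^-1` [set y]).
  rewrite -GE; apply: fin_bigcup_measurable; first exact: finite_setIl.
  by move=> y _; rewrite GE.
apply/seteqP; split=> [w Bw|w [y [_ By] /= wy]]; last by rewrite /= wy.
by exists (t w) => //; split => //; exists w.
Qed.

Lemma sigma_bounded_part s N : (forall k, simple_for G (s k)) ->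
  G (bounded_part s N).
Proof.
have GE := measurable_g_measurableTypeE sG.
move=> Gs; rewrite (_ : bounded_part s N =
  \bigcap_k (s k @^-1` [set y | `|y| <= N%:R])).
  rewrite -GE; apply: bigcapT_measurable => k; rewrite GE.
  exact: sigma_preimage.
by apply/seteqP; split=> [w sw k _|w sw k] //; exact: sw.
Qed.

Lemma simple_truncated B (t : {fimfun T >-> Y}) :
  G B -> simple_for G t -> simple_for G (truncated B t).
Proof.
have GE := measurable_g_measurableTypeE sG.
move=> GB Gt y; have [y0|y0] := pselect (y = 0).
  rewrite (_ : _ @^-1` _ = (B `&` t @^-1` [set y]) `|` ~` B).
    rewrite -GE; apply: measurableU; last by apply: measurableC; rewrite GE.
    by apply: measurableI; rewrite GE.
  apply/seteqP; split=> [w|w] /=; rewrite /truncation.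
    by case: ifPn => [/set_mem|wB _]; [left|right => /mem_set; exact/negP].
  case: ifPn => [/set_mem wB|/negP wB] [[wB' ty]|wB'] //.
rewrite (_ : _ @^-1` _ = B `&` t @^-1` [set y]).
  by rewrite -GE; apply: measurableI; rewrite GE.
apply/seteqP; split=> [w|w [/mem_set wB]] /=; rewrite /truncation.
  by case: ifPn => [/set_mem//|_ /esym].
by rewrite wB.
Qed.

End sub_sigma_algebra.

Lemma bounded_part_mono s N M : (N <= M)%N ->
  bounded_part s N `<=` bounded_part s M.
Proof. by move=> NM w sw k; rewrite (le_trans (sw k))// ler_nat. Qed.

Section limit.
Variables (s : nat -> {fimfun T >-> Y}) (f : T -> Y).
Hypothesis sf : forall w, s k w @[k --> \oo] --> f w.

Lemma bounded_part_cover w : \forall N \near \oo, bounded_part s N w.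
Proof.
have /cvg_seq_bounded/pinfty_ex_gt0[M M0 sM] : cvgn (s ^~ w).
  by apply/cvg_ex; exists (f w).
exists (Num.truncn M).+1 => // N /= MN k.
apply: (@le_trans _ _ M); first exact: sM.
by rewrite (le_trans (ltW (truncnS_gt M)))// ler_nat.
Qed.

Lemma bounded_part_limit N w : bounded_part s N w -> `|f w| <= N%:R.
Proof.
move=> sN; apply/ler_addgt0Pr => e e0.
have /cvgrPdist_le/(_ _ e0)/filter_ex[k fk] := @sf w.
rewrite -(subrK (s k w) (f w)) addrC (le_trans (ler_normD _ _))// lerD//.
Qed.

End limit.

Lemma measurable_EFin_powR (v : T -> R) (p : R) : measurable_fun setT v ->
  measurable_fun setT (fun w => (v w `^ p)%:E).
Proof.
by move=> mv; apply/measurable_EFinP; exact: (measurableT_comp (measurable_powR _)).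
Qed.

Lemma integral_powR_cvg0 (p : R) (u : nat -> T -> R) (g : T -> R) : 0 < p ->
  (forall k, measurable_fun setT (u k)) -> measurable_fun setT g ->
  (forall k w, 0 <= u k w <= g w) ->
  (\int[P]_w (g w `^ p)%:E < +oo)%E ->
  (forall w, u k w @[k --> \oo] --> (0 : R)) ->
  (\int[P]_w (u k w `^ p)%:E @[k --> \oo] --> 0)%E.
Proof.
move=> p0 mu mg ug ig u0.
have mp := fun v => @measurable_EFin_powR v p.
have [|||||_ _] := @dominated_convergence _ T R P setT measurableT
  (fun k w => (u k w `^ p)%:E) (cst 0%E) (fun w => (g w `^ p)%:E).
- by move=> k; exact: mp.
- exact: measurable_cst.
- apply: aeW => w _; apply: cvg_EFin; first exact: nearW.
  apply/cvgrPdist_le => e e0; near=> k.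
  rewrite /= sub0r normrN ger0_norm ?powR_ge0//.
  have -> : e = (e `^ p^-1) `^ p by rewrite -powRrM mulVf ?gt_eqF// powRr1// ltW.
  have /andP[uk _] := ug k w.
  rewrite ge0_ler_powR ?nnegrE ?powR_ge0 ?(ltW p0)//.
  rewrite -[leLHS](ger0_norm uk) -[u k w]subr0 distrC; near: k.
  by move/cvgrPdist_le : (u0 w); apply; exact: powR_gt0.
- apply/integrableP; split; first exact: mp.
  by under eq_integral do rewrite gee0_abs ?lee_fin ?powR_ge0//.
- apply: aeW => w k _; rewrite gee0_abs ?lee_fin ?powR_ge0//.
  have /andP[uk ukg] := ug k w.
  by rewrite ge0_ler_powR ?nnegrE ?(ltW p0)// (le_trans uk).
by rewrite integral_cst// mul0e.
Unshelve. all: by end_near. Qed.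

Lemma indic_mul_measurable (B : set T) (h : T -> R) :
  measurable B -> measurable_fun setT h ->
  measurable_fun setT (fun w => (w \in B)%:R * h w).
Proof.
move=> mB mh; apply: measurable_funM => //.
by rewrite (_ : (fun w => _) = \1_B); [exact: measurable_indic|apply/funext => w; rewrite indicE].
Qed.

(** Convergence is dominated by the constant 2N. *)
Lemma bounded_part_approx s f (p : R) N :
  0 < p -> (forall k, simple_for d.-measurable (s k)) ->
  (forall w, s k w @[k --> \oo] --> f w) ->
  (\int[P]_w (((w \in bounded_part s N)%:R * `|f w - s k w|) `^ p)%:E
    @[k --> \oo] --> 0)%E.
Proof.
move=> p0 ms sf.
have mf : smeasurable f by exists s.
have mB := sigma_bounded_part (@sigma_algebra_measurable _ T) N ms.
apply: (@integral_powR_cvg0 p _ (cst (2 * N%:R))) => //.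
- move=> k; apply: indic_mul_measurable => //; apply: measurable_dist => //.
  exact: simple_strongly_measurable.
- move=> k w; have [/set_mem wB|_] := boolP (w \in bounded_part s N);
    last by rewrite mul0r lexx mulr_ge0.
  rewrite mul1r normr_ge0/= (le_trans (ler_normB _ _))// mulr_natl mulr2n lerD//.
  exact: bounded_part_limit wB.
- rewrite (eq_integral (cst (((2 * N%:R) `^ p)%:E)))// integral_cst//.
  by rewrite [X in (_ * X)%E]probability_setT mule1 ltry.
- move=> w; have [_|_] := boolP (w \in bounded_part s N); last first.
    by under eq_fun do rewrite mul0r; exact: cvg_cst.
  under eq_fun do rewrite mul1r.
  rewrite -(@normr0 _ Y) -(subrr (f w)).
  by apply: cvg_norm; apply: cvgB; [exact: cvg_cst|exact: sf].
Qed.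

Lemma Lp_norm_le (f : T -> Y) (p e : R) : 0 < p -> 0 <= e ->
  (Lp_norm P p f <= e%:E)%E = (\int[P]_w (`|f w| `^ p)%:E <= (e `^ p)%:E)%E.
Proof.
move=> p0 e0; have pN0 : p != 0 by rewrite gt_eqF.
rewrite -(Lp_norm_powR P f pN0) -poweR_EFin; apply/idP/idP => h.
  by apply: gt0_ler_poweR; rewrite ?(ltW p0)// in_itv/= leey ?lee_fin ?e0// Lp_norm_ge0.
have := gt0_ler_poweR (r := p^-1) _ _ _ h.
rewrite -!poweRrM mulfV// !poweRe1 ?Lp_norm_ge0 ?lee_fin//; apply.
- by rewrite invr_ge0 ltW.
- by rewrite in_itv/= leey poweR_ge0.
- by rewrite in_itv/= leey lee_fin powR_ge0.
Qed.

(** Truncate the approximants to the set where they are bounded by N: the error is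
    small off this set because f is in L_p, and on it by bounded convergence. *)
Lemma simple_dense G (p : R) f (e : R) : 1 < p -> sigma_algebra setT G ->
  G `<=` d.-measurable -> strongly_measurable G f -> (Lp_norm P p f < +oo)%E ->
  0 < e -> exists s : {fimfun T >-> Y},
    simple_for G s /\ (Lp_norm P p (fun w => f w - s w)%R <= e%:E)%E.
Proof.
move=> p1 sG GT mGf fp e0; have p0 : 0 < p by exact: lt_trans p1.
have mf := strongly_measurable_sub GT mGf.
have [s [Gs sf]] := mGf.
have ms k : simple_for d.-measurable (s k) by move=> y; exact/GT/Gs.
have mB N := sigma_bounded_part (@sigma_algebra_measurable _ T) N ms.
have ep0 : 0 < e `^ p / 2 by rewrite divr_gt0 ?powR_gt0.
have ifp : (\int[P]_w (`|f w| `^ p)%:E < +oo)%E.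
  by rewrite -Lp_norm_powR ?gt_eqF// poweR_lty.
have /(cvge0_near_lt ep0)/filter_ex[N fN] :
    (\int[P]_w (((w \notin bounded_part s N)%:R * `|f w|) `^ p)%:E
      @[N --> \oo] --> 0)%E.
  apply: (@integral_powR_cvg0 p _ (fun w => `|f w|)) => //.
  - move=> N; rewrite (_ : (fun w => _) =
      (fun w => (w \in ~` bounded_part s N)%:R * `|f w|)).
      by apply: indic_mul_measurable; [exact: measurableC|exact: measurable_norm].
    by apply/funext => w; rewrite in_setC.
  - exact: measurable_norm.
  - by move=> N w; case: (_ \notin _); rewrite ?mul1r ?mul0r normr_ge0 lexx.
  - move=> w; apply: cvg_near_cst; apply: filterS (bounded_part_cover sf w).
    by move=> N /mem_set ->; rewrite mul0r.
have /(cvge0_near_lt ep0)/filter_ex[k fk] := bounded_part_approx N p0 ms sf.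
exists (truncated (bounded_part s N) (s k)); split.
  apply: simple_truncated => //; exact: sigma_bounded_part.
rewrite Lp_norm_le ?(ltW e0)//.
rewrite (eq_integral (fun w =>
  ((((w \in bounded_part s N)%:R * `|f w - s k w|) `^ p)%:E +
   (((w \notin bounded_part s N)%:R * `|f w|) `^ p)%:E))%E); last first.
  move=> w _; rewrite /= /truncation -EFinD; congr _%:E.
  have p00 : 0 `^ p = 0 :> R by rewrite powR0// gt_eqF.
  by case: ifP => _; rewrite /= !mul1r !mul0r p00 ?addr0// subr0 add0r.
have mp := fun v => @measurable_EFin_powR v p.
have m1 : measurable_fun setT (fun w =>
    (((w \in bounded_part s N)%:R * `|f w - s k w|) `^ p)%:E).
  apply: mp; apply: indic_mul_measurable => //; apply: measurable_dist => //.
  exact: simple_strongly_measurable.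
have m2 : measurable_fun setT (fun w =>
    (((w \notin bounded_part s N)%:R * `|f w|) `^ p)%:E).
  apply: mp; rewrite (_ : (fun w => _) =
    (fun w => (w \in ~` bounded_part s N)%:R * `|f w|)).
    by apply: indic_mul_measurable; [exact: measurableC|exact: measurable_norm].
  by apply/funext => w; rewrite in_setC.
rewrite (ge0_integralD P measurableT _ m1 _ m2) => [|w _|w _];
  rewrite ?lee_fin ?powR_ge0//.
rewrite (splitr (e `^ p)) EFinD.
exact: (leeD (ltW fk) (ltW fN)).
Qed.

End density.

Section finite_approximation.
Local Open Scope classical_set_scope.
Context {R : realType} {Y : normedModType R}.
Context {d} {T : measurableType d} (P : probability T R).
Variable p : R.
Hypothesis p1 : 1 < p.
Local Notation smeasurable := (strongly_measurable d.-measurable).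
Local Notation rnorm h := (Lnorm P p%:E (EFin \o h)).

Let p0 : 0 < p. Proof. exact: lt_trans p1. Qed.
Let pN0 : p != 0. Proof. by rewrite gt_eqF. Qed.

Lemma le_Lnorm_integral (g h : T -> R) :
  (forall w, 0 <= g w) -> (forall w, 0 <= h w) ->
  (\int[P]_w (g w `^ p)%:E <= \int[P]_w (h w `^ p)%:E)%E ->
  (rnorm g <= rnorm h)%E.
Proof.
move=> g0 h0 gh; rewrite unlock; apply: gt0_ler_poweR.
- by rewrite invr_ge0 ltW.
- by rewrite in_itv/= leey integral_ge0// => w _; rewrite poweR_ge0.
- by rewrite in_itv/= leey integral_ge0// => w _; rewrite poweR_ge0.
rewrite (eq_integral (fun w => (g w `^ p)%:E)) => [|w _]; last first.
  by rewrite /= ger0_norm.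
rewrite [leRHS](eq_integral (fun w => (h w `^ p)%:E)) => // w _.
by rewrite /= ger0_norm.
Qed.

Lemma Lp_norm_condexp_coded (Z K : finType) (c : T -> Z) (pi : Z -> K)
    (g : Z -> Y) : (forall z, measurable (c @^-1` [set z])) ->
  (Lp_norm P p (condexp (law P c) pi g \o c) <= Lp_norm P p (g \o c))%E.
Proof.
move=> mc; have [q q1 pq] := conjugate_exists p1.
rewrite !(Lp_norm_coded P mc _ pN0) lee_fin.
have S0 (a : Z -> Y) : 0 <= \sum_z law P c z * `|a z| `^ p.
  by rewrite sumr_ge0// => z _; rewrite mulr_ge0 ?powR_ge0 ?law_ge0.
rewrite ge0_ler_powR ?nnegrE ?invr_ge0 ?(ltW p0)//.
apply: (condexp_contraction (law_ge0 P c) pi g (p := q)) => //.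
- exact: lt_trans q1.
- by rewrite addrC.
Qed.

Lemma Lp_norm_leB (f g : T -> Y) : smeasurable f -> smeasurable g ->
  (Lp_norm P p f <= Lp_norm P p (fun w => f w - g w)%R + Lp_norm P p g)%E.
Proof.
move=> mf mg; apply: Lp_norm_leD => //; first exact: strongly_measurableB.
by move=> w; rewrite (le_trans _ (ler_normD _ _))// subrK.
Qed.

Lemma Lp_norm_distC (f g : T -> Y) :
  Lp_norm P p (fun w => f w - g w) = Lp_norm P p (fun w => g w - f w).
Proof. by rewrite /Lp_norm; apply: eq_Lnorm => w; rewrite distrC. Qed.

Lemma sigma_mem_eq (G : set_system T) (B : set T) (b : bool) :
  sigma_algebra setT G -> G B -> G [set w | (w \in B) = b].
Proof.
move=> sG GB; have GE := measurable_g_measurableTypeE sG.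
case: b.
  rewrite (_ : [set w | _] = B)//.
  by apply/seteqP; split=> w /=; [exact: set_mem|exact: mem_set].
rewrite (_ : [set w | _] = ~` B); first by rewrite -GE; apply: measurableC; rewrite GE.
apply/seteqP; split=> w /=; first by move=> wB /mem_set; rewrite wB.
by move=> wB; apply/memNset.
Qed.

(** On the set B N where the approximants of [Ef] are bounded by N, [Ef] is close
    in L_p to an average of a simple approximation u of [f] over a finite partition.
    Such averages contract the norm, so the L_p norm of [Ef] on B N is at most
    3 + |u|_p, uniformly in N. *)
Lemma cond_expectation_in_Lp (F : set_system T) (f Ef : T -> Y) :
  sigma_algebra setT F -> F `<=` d.-measurable ->
  is_cond_expectation P F f Ef -> in_Lp P p f -> in_Lp P p Ef.
Proof.
move=> sF FT fE [mf fp]; have [mE _] := fE.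
have mEf := strongly_measurable_sub FT mE.
split=> //; have [q q1 pq] := conjugate_exists p1.
have q0 : 0 < q by exact: lt_trans q1.
have [s [Fs sE]] := mE.
have ms k : simple_for d.-measurable (s k) by move=> y; exact/FT/Fs.
have [u [mu fu]] := simple_dense p1 (@sigma_algebra_measurable _ T)
  (@subset_refl _ _) mf fp ltr01.
have smu := simple_strongly_measurable mu.
have uoo : (Lp_norm P p u < +oo)%E.
  apply: (@le_lt_trans _ _ (1%:E + Lp_norm P p f)%E); last first.
    by rewrite lte_add_pinfty// ltry.
  apply: (le_trans (Lp_norm_leB smu mf)).
  by rewrite leeD2r// Lp_norm_distC.
pose C := fine (3%:E + Lp_norm P p u)%E.
have C0 : 0 <= C by rewrite fine_ge0// adde_ge0// Lp_norm_ge0.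
have CE : (C%:E = 3%:E + Lp_norm P p u)%E.
  by rewrite fineK// fin_numD/= ge0_fin_numE// Lp_norm_ge0.
pose B N := bounded_part s N.
have FB N : F (B N) by exact: sigma_bounded_part.
have mB N : measurable (B N) by exact/FT/FB.
have mBE N (h : T -> R) := indic_mul_measurable (h := h) (mB N).
have bound N : (\int[P]_w (((w \in B N)%:R * `|Ef w|) `^ p)%:E <= (C `^ p)%:E)%E.
  have /(cvge0_near_lt ltr01)/filter_ex[k Ek] := bounded_part_approx P N p0 ms sE.
  pose t := truncated (B N) (s k).
  have Ft : simple_for F t by exact: simple_truncated.
  pose st (b : bool) := if b then t else u.
  have mst b : simple_for d.-measurable (st b).
    by case: b => // y; exact/FT/Ft.
  pose c w := (code st w, w \in B N).
  have mc z : measurable (c @^-1` [set z]).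
    case: z => v b; rewrite (_ : _ @^-1` _ =
      code st @^-1` [set v] `&` [set w | (w \in B N) = b]).
      apply: measurableI; first exact: measurable_code.
      exact: (sigma_mem_eq b (@sigma_algebra_measurable _ T) (mB N)).
    apply/seteqP; split=> w; first by case=> cv cb; split.
    by move=> [/= cv cb]; rewrite /c/= cv cb.
  pose I := 'I_(code_bound st).+1.
  pose pi (z : {ffun bool -> I} * bool) := (z.1 true, z.2).
  pose phi (z : {ffun bool -> I} * bool) := decode (s := st) false (z.1 false).
  pose psi (z : {ffun bool -> I} * bool) := decode (s := st) true (z.1 true).
  have uE w : phi (c w) = u w by exact: esym (decodeK st false w).
  have tE w : psi (c w) = t w by exact: esym (decodeK st true w).
  have Fpi k' : F ((pi \o c) @^-1` [set k']).
    have GE := measurable_g_measurableTypeE sF.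
    case: k' => i b; rewrite (_ : _ @^-1` _ =
      [set w | forall j, pred1 true j -> code st w j = [ffun=> i] j] `&`
      [set w | (w \in B N) = b]).
      rewrite -GE; apply: measurableI; rewrite GE.
        by apply: sigma_algebra_cylinder => // j /eqP ->.
      exact: sigma_mem_eq.
    apply/seteqP; split=> w.
      by case=> ci cb; split=> // j /eqP ->; rewrite ffunE.
    by move=> [/(_ true (eqxx _)) E wb]; rewrite /pi/= E wb ffunE.
  have dist := @condexp_coded_dist _ _ _ _ P _ _ c pi mc F f Ef phi psi
    (fun z => z.2) p q p0 q0 pq FT Fpi fE mf.
  have {}dist := dist (fun x y xy => congr1 (decode true) (congr1 fst xy))
    (fun x y xy => congr1 snd xy).
  pose h1 w := (w \in B N)%:R * `|Ef w - s k w|.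
  pose h2 w := (w \in B N)%:R * `|condexp (law P c) pi phi (c w) - psi (c w)|.
  pose h3 w := `|condexp (law P c) pi phi (c w)|.
  have sc (g : _ -> Y) := strongly_measurable_coded_measurable mc g.
  have m1 : measurable_fun setT h1.
    by apply: mBE; apply: measurable_dist => //; exact: simple_strongly_measurable.
  have m2 : measurable_fun setT h2.
    exact/mBE/(measurable_dist (sc (condexp (law P c) pi phi)) (sc psi)).
  have m3 : measurable_fun setT h3 by exact: (measurable_norm (sc (condexp (law P c) pi phi))).
  have mfu : measurable_fun setT (fun w => `|f w - u w|) by exact: measurable_dist.
  have n1 : (rnorm h1 <= 1)%E.
    have -> : (1%E : \bar R) = rnorm (cst 1).
      rewrite Lnorm_cst1 [X in (X `^ _)%E]probability_setT.
      by rewrite poweR1r.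
    have h10 w : 0 <= h1 w by rewrite mulr_ge0.
    apply: (le_Lnorm_integral h10 (fun=> ler01)).
    rewrite [leRHS](eq_integral (cst 1%E)) => [|w _]; last by rewrite /= powR1.
    by rewrite integral_cst// mul1e [leRHS]probability_setT ltW.
  have n2 : (rnorm h2 <= 2%:E)%E.
    apply: (@le_trans _ _ (rnorm (fun w => `|f w - u w| + h1 w)%R)).
      apply: (@le_trans _ _ (rnorm (fun w => (w \in B N)%:R *
          (`|f w - phi (c w)| + `|Ef w - psi (c w)|))%R)).
        by apply: le_Lnorm_integral => // w; rewrite mulr_ge0// addr_ge0.
      apply: le_Lnorm => //.
      - apply: mBE; apply: measurable_funD; first exact: (measurable_dist mf (sc phi)).
        exact: (measurable_dist mEf (sc psi)).
      - exact: measurable_funD.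
      - move=> w; rewrite !ger0_norm ?addr_ge0 ?mulr_ge0 ?addr_ge0//.
        rewrite uE tE mulrDr lerD// /h1 /= ?/truncation.
          by case: (_ \in _); rewrite ?mul1r ?mul0r.
        by case: (_ \in _); rewrite ?mul0r.
    apply: (le_trans (minkowski_EFin _ mfu m1 (ltW p1))).
    by rewrite (_ : 2%:E = 1%:E + 1%:E)%E ?leeD// -EFinD.
  have n3 : (rnorm h3 <= Lp_norm P p u)%E.
    apply: (le_trans (Lp_norm_condexp_coded pi phi mc)).
    by rewrite /Lp_norm (eq_Lnorm _ _ (g := fun w => `|u w|%:E))// => w /=; rewrite uE.
  have : (rnorm (fun w => (w \in B N)%:R * `|Ef w|)%R <= C%:E)%E.
    rewrite CE; apply: (@le_trans _ _
      (\sum_(h <- [:: h1; h2; h3]) rnorm h)%E).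
      have mh : forall i : 'I_3, measurable_fun setT (nth h1 [:: h1; h2; h3] i).
        by case=> [[|[|[|]]]].
      have := Lnorm_sum P p1 (index_enum 'I_3) mh.
      rewrite !big_ord_recl !big_ord0 !big_cons big_nil/=; apply: le_trans.
      apply: le_Lnorm => //.
      - by apply: mBE; exact: measurable_norm.
      - by apply: measurable_sum.
      - move=> w; rewrite !big_ord_recl !big_ord0/= addr0.
        rewrite ger0_norm ?mulr_ge0// (le_trans _ (ler_norm _))//.
        rewrite /h1 /h2 /h3 tE /= /truncation.
        case: (w \in B N); rewrite ?mul1r ?mul0r ?add0r//.
        rewrite addrA -[in leLHS](subrK (s k w) (Ef w)).
        rewrite (le_trans (ler_normD _ _))// -addrA lerD2l.
        rewrite -[in leLHS](subrK (condexp (law P c) pi phi (c w)) (s k w)).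
        by rewrite (le_trans (ler_normD _ _))// distrC.
    rewrite !big_cons big_nil adde0 addeA leeD//.
    by rewrite (_ : 3%:E = 1%:E + 2%:E)%E ?leeD// -EFinD; congr _%:E; lra.
  have := @Lp_norm_le _ _ _ _ P (fun w => (w \in B N)%:R *: Ef w) p C p0 C0.
  rewrite /Lp_norm.
  under [in X in (X <= _)%E = _ -> _]eq_Lnorm do rewrite normrZ ger0_norm//.
  move=> ->; apply: le_trans; rewrite le_eqVlt; apply/orP; left; apply/eqP.
  by apply: eq_integral => w _; rewrite normrZ ger0_norm.
pose g N w := (((w \in B N)%:R * `|Ef w|) `^ p)%:E.
have mg N : measurable_fun setT (g N).
  apply/measurable_EFinP/(measurableT_comp (measurable_powR _)).
  by apply: mBE; exact: measurable_norm.
have g0 N w : setT w -> (0 <= g N w)%E by move=> _; rewrite lee_fin powR_ge0.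
have gnd w : setT w -> nondecreasing_seq (g ^~ w).
  move=> _ N M NM; rewrite lee_fin ge0_ler_powR ?nnegrE ?mulr_ge0 ?(ltW p0)//.
  rewrite ler_wpM2r// ler_nat.
  have [/set_mem wN|//] := boolP (w \in B N).
  by rewrite (mem_set (bounded_part_mono NM wN)).
have gcvg := @cvg_monotone_convergence _ _ _ P _ measurableT g mg g0 gnd.
rewrite (@le_lt_trans _ _ C%:E) ?ltry// Lp_norm_le//.
rewrite (eq_integral (fun w => limn (g ^~ w))) => [|w _].
  by apply: (cvge_le _ gcvg); apply: nearW.
apply/esym/cvg_lim => //; apply: cvg_near_cst.
apply: filterS (bounded_part_cover sE w) => N /mem_set wN.
by rewrite /g wN mul1r.
Qed.

End finite_approximation.

(** * From finite sets to arbitrary filtrations *)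

(** [None] hides a coordinate, so that two codes have the same view exactly when
    they agree on the visible coordinates. *)
Definition level_view (J I : finType) (lev : J -> nat) (k : nat)
    (v : {ffun J -> I}) : {ffun J -> option I} :=
  [ffun j => if (lev j <= k)%N then Some (v j) else None].

Lemma refining_level_view (J I : finType) (lev : J -> nat) :
  refining (@level_view J I lev).
Proof.
move=> i k ik x y /ffunP E; apply/ffunP => j; rewrite !ffunE.
case: ifP => // ji; have := E j; rewrite !ffunE (leq_trans ji ik).
by [].
Qed.

Lemma level_view_le (J I : finType) (lev : J -> nat) k (x y : {ffun J -> I}) j :
  (lev j <= k)%N -> level_view lev k x = level_view lev k y -> x j = y j.
Proof. by move=> jk /ffunP/(_ j); rewrite !ffunE jk => -[]. Qed.

Section levels.
Local Open Scope classical_set_scope.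
Context {R : realType} {Y : normedModType R}.
Context {d} {T : measurableType d} (P : probability T R).
Context {J : finType} (s : J -> {fimfun T >-> Y}) (lev : J -> nat).
Hypothesis ms : forall j, simple_for d.-measurable (s j).

Definition coordinate j (v : {ffun J -> 'I_(code_bound s).+1}) : Y :=
  decode (s := s) j (v j).

Lemma coordinateK j : coordinate j \o code s = s j.
Proof. by apply/funext => w; rewrite /coordinate/= -decodeK. Qed.

Definition averaged k j : T -> Y :=
  condexp (law P (code s)) (level_view lev k) (coordinate j) \o code s.

(** The errors of [s j] and [s i] both enter the distance from the average of [s j]
    to [s i], which is constant on the cells because it is visible at level [k]; the
    third e is the distance from [s i] to [Ef]. *)
Lemma averaged_approx (F : set_system T) (f Ef : T -> Y) (p e : R) k i j :
  1 < p -> 0 <= e -> sigma_algebra setT F -> F `<=` d.-measurable ->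
  (forall l, (lev l <= k)%N -> simple_for F (s l)) -> (lev i <= k)%N ->
  is_cond_expectation P F f Ef -> strongly_measurable d.-measurable f ->
  (Lp_norm P p (fun w => f w - s j w)%R <= e%:E)%E ->
  (Lp_norm P p (fun w => Ef w - s i w)%R <= e%:E)%E ->
  (Lp_norm P p (fun w => averaged k j w - Ef w)%R <= (3 * e)%:E)%E.
Proof.
move=> p1 e0 sF FT Fs ik fE mf fj Ei; have [mE _] := fE.
have p0 : 0 < p by exact: lt_trans p1.
have mEf := strongly_measurable_sub FT mE.
have [q q1 pq] := conjugate_exists p1.
have q0 : 0 < q by exact: lt_trans q1.
have mc v := measurable_code v ms.
have sc g := strongly_measurable_coded_measurable mc g.
have Fpi k' : F ((level_view lev k \o code s) @^-1` [set k']).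
  have [[w0 w0k]|none] := pselect (exists w, level_view lev k (code s w) = k').
    rewrite (_ : _ @^-1` _ =
      [set w | forall l, (lev l <= k)%N -> code s w l = code s w0 l]).
      by apply: sigma_algebra_cylinder.
    apply/seteqP; split=> w /=.
      by rewrite -w0k => E l lk; exact: level_view_le lk E.
    move=> E; rewrite -w0k; apply/ffunP => l; rewrite [LHS]ffunE [RHS]ffunE.
    by case: ifP => // lk; rewrite E.
  rewrite (_ : _ @^-1` _ = set0); first by case: sF.
  by rewrite -subset0 => w wk; case: none; exists w.
have := @condexp_coded_dist _ _ _ _ P _ _ (code s) (level_view lev k) mc F f Ef
  (coordinate j) (coordinate i) xpredT p q p0 q0 pq FT Fpi fE mf.
have iE x y : level_view lev k x = level_view lev k y ->
    coordinate i x = coordinate i y.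
  by move=> /(level_view_le ik); rewrite /coordinate => ->.
move=> /(_ iE (fun _ _ _ => erefl)) dist.
have n1 : (Lp_norm P p (fun w => averaged k j w - s i w)%R <= (e + e)%:E)%E.
  have mfj : measurable_fun setT (fun w => `|f w - s j w|).
    by apply: measurable_dist => //; exact: simple_strongly_measurable (ms j).
  have mEi : measurable_fun setT (fun w => `|Ef w - s i w|).
    by apply: measurable_dist => //; exact: simple_strongly_measurable (ms i).
  apply: (@le_trans _ _ (Lnorm P p%:E (EFin \o
      (fun w => `|f w - s j w| + `|Ef w - s i w|)%R))).
    have avg0 w : 0 <= `|averaged k j w - s i w| by [].
    have sum0 w : 0 <= `|f w - s j w| + `|Ef w - s i w| by rewrite addr_ge0.
    apply: (le_Lnorm_integral p1 avg0 sum0).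
    move: dist; under eq_integral do rewrite mul1r.
    under [in X in (_ <= X)%E -> _]eq_integral do rewrite mul1r.
    by rewrite -(coordinateK j) -(coordinateK i).
  apply: (le_trans (minkowski_EFin _ mfj mEi (ltW p1))).
  by rewrite EFinD leeD.
have mavg : strongly_measurable d.-measurable (averaged k j) by exact: sc.
have msi := simple_strongly_measurable (ms i).
rewrite (_ : 3 * e = (e + e) + e); last by lra.
apply: (le_trans (Lp_norm_leD P p1 (strongly_measurableB mavg mEf)
  (strongly_measurableB mavg msi) (strongly_measurableB msi mEf) _)).
  by move=> w; rewrite -{1}(subrKA (s i w)) ler_normD.
by rewrite EFinD leeD// Lp_norm_distC.
Qed.

End levels.

Lemma lee_eps_const {R : realType} (a b : \bar R) (C : R) : 0 <= C ->
  (forall e : R, 0 < e -> (a <= b + (C * e)%:E)%E) -> (a <= b)%E.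
Proof.
move=> C0 ab; apply/lee_addgt0Pr => e e0.
have C1 : 0 < C + 1 by rewrite ltr_pwDr.
apply: (le_trans (ab (e / (C + 1)) _)); first by rewrite divr_gt0.
rewrite leeD2l// lee_fin mulrCA ler_piMr ?(ltW e0)//.
by rewrite ler_pdivrMr// mul1r lerDl.
Qed.

Lemma le_root (R : realType) (p C A B : R) : 0 < p -> 0 <= C -> 0 <= A ->
  0 <= B -> A <= C `^ p * B -> A `^ p^-1 <= C * B `^ p^-1.
Proof.
move=> p0 C0 A0 B0 AB.
have -> : C * B `^ p^-1 = (C `^ p * B) `^ p^-1.
  by rewrite powRM ?powR_ge0// -powRrM mulfV ?gt_eqF// powRr1.
by rewrite ge0_ler_powR ?nnegrE ?invr_ge0 ?(ltW p0)// mulr_ge0 ?powR_ge0.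
Qed.

Section duality.
Context {R : realType} (X : completeNormedModType R).
Variables p q b : R.
Hypotheses (p1 : 1 < p) (q1 : 1 < q) (pq : p^-1 + q^-1 = 1) (b0 : 0 < b).
Hypothesis umd : finite_umd_plus (dual X) q b.

Let p0 : 0 < p. Proof. exact: lt_trans p1. Qed.
Let pN0 : p != 0. Proof. by rewrite gt_eqF. Qed.
Let C0 : 0 <= 4 * b. Proof. by rewrite mulr_ge0// ltW. Qed.

Lemma average_ge0 (Z : finType) (w : Z -> R) (a : Z -> X) :
  (forall z, 0 <= w z) -> 0 <= \sum_z w z * `|a z| `^ p.
Proof. by move=> w0; rewrite sumr_ge0// => z _; rewrite mulr_ge0 ?powR_ge0. Qed.

Lemma cube_sum_ge0 n (Z : finType) (w : Z -> R)
    (a : {ffun 'I_n -> bool} -> Z -> X) : (forall z, 0 <= w z) ->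
  0 <= 2 ^- n * \sum_e \sum_z w z * `|a e z| `^ p.
Proof.
move=> w0; rewrite mulr_ge0 ?invr_ge0 ?exprn_ge0// sumr_ge0// => e _.
exact: average_ge0.
Qed.

(** Each M_i is approximated by an F_i-simple t_i, and M'_i is the average of t_n
    over the cells cut out by t_0, ..., t_i; M' is a martingale on a finite set,
    within 3e of M. *)
Lemma umd_minus_of_finite n (d : measure_display) (T : measurableType d)
    (P : probability T R) (F : 'I_n.+1 -> set_system T) (M : 'I_n.+1 -> T -> X) :
  filtration F -> martingale P F M -> (forall i, in_Lp P p (M i)) ->
  (Lp_norm P p (M ord_max \- M ord0)%R <=
    (4 * b)%:E * cube_average P p (martingale_diff M))%E.
Proof.
move=> [sF FF] [mM MM] Mp.
have mMT i : strongly_measurable d.-measurable%classic (M i) by case: (Mp i).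
apply: (@lee_eps_const _ _ _ (4 * b * (n%:R * 6) + 6)) => [|e e0].
  by rewrite addr_ge0// mulr_ge0// mulr_ge0.
have /choice[t tP] : forall i, exists s : {fimfun T >-> X}, simple_for (F i) s /\
    (Lp_norm P p (fun w => M i w - s w)%R <= e%:E)%E.
  move=> i; case: (sF i) => sFi FT.
  by apply: simple_dense => //; case: (Mp i).
have mt i : simple_for d.-measurable%classic (t i).
  by move=> y; apply: (sF i).2; case: (tP i) => + _; exact.
pose lev (j : 'I_n.+1) : nat := j.
pose M' (i : 'I_n.+1) := averaged P t lev i ord_max.
have M'M i : (Lp_norm P p (fun w => M' i w - M i w)%R <= (3 * e)%:E)%E.
  apply: (@averaged_approx _ _ _ _ P _ t lev mt (F i) (M ord_max) (M i) p e i i ord_max)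
    => //; rewrite ?(ltW e0)//.
  - by case: (sF i).
  - by case: (sF i).
  - by move=> l li y; apply: (FF l i li); case: (tP l) => + _; exact.
  - by apply: MM; rewrite leq_ord.
  - by case: (tP ord_max).
  - by case: (tP i).
have mM' i : strongly_measurable d.-measurable%classic (M' i).
  exact: (strongly_measurable_coded_measurable (fun v => measurable_code v mt)).
pose mc v := measurable_code v mt.
have w0 := law_ge0 P (code t).
have fin : (Lp_norm P p (M' ord_max \- M' ord0)%R <=
    (4 * b)%:E * cube_average P p (martingale_diff M'))%E.
  have := finite_umd_minus p1 q1 pq b0 umd w0 (sum_law P mc)
    (@refining_level_view _ _ lev) n (coordinate (s := t) ord_max).
  move=> /(le_root p0 C0 (average_ge0 _ w0) (cube_sum_ge0 _ w0)).
  rewrite -lee_fin EFinM -(Lp_norm_coded P mc _ pN0).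
  by rewrite -(cube_average_coded P mc (fun k => condexp_diff _ _ k _) pN0).
have mMM i j : strongly_measurable d.-measurable%classic (fun w => M i w - M j w).
  exact: strongly_measurableB.
have mMM' i j : strongly_measurable d.-measurable%classic (fun w => M' i w - M' j w).
  exact: strongly_measurableB.
have mD i : strongly_measurable d.-measurable%classic (fun w => M' i w - M i w).
  exact: strongly_measurableB.
have near (i j : 'I_n.+1) : (Lp_norm P p
    (fun w => (M' i w - M' j w) - (M i w - M j w))%R <= (6 * e)%:E)%E.
  apply: (le_trans (Lp_norm_leD P p1 (strongly_measurableB (mMM' i j) (mMM i j))
    (mD i) (mD j) _)).
    move=> w; apply: le_trans (ler_normB _ _).
    by rewrite !opprD addrACA.
  rewrite (_ : 6 * e = 3 * e + 3 * e); last by lra.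
  by rewrite EFinD leeD.
have first_step : (Lp_norm P p (M ord_max \- M ord0)%R <=
    Lp_norm P p (M' ord_max \- M' ord0)%R + (6 * e)%:E)%E.
  apply: (le_trans (Lp_norm_leB P p1 (mMM _ _) (mMM' _ _))).
  by rewrite addeC; apply: leeD2l; rewrite Lp_norm_distC; exact: near.
apply: (le_trans first_step).
rewrite (mulrDl (4 * b * _)) EFinD addeA leeD2r//.
apply: (le_trans fin).
have -> : 4 * b * (n%:R * 6) * e = 4 * b * (n%:R * (6 * e)) by ring.
rewrite (EFinM (4 * b) _) -muleDr//; last first.
  rewrite ge0_adde_def// inE; first exact: poweR_ge0.
  by rewrite lee_fin !mulr_ge0// ltW.
rewrite lee_wpmul2l ?lee_fin//.
apply: (cube_average_perturb p1) => //.
- by rewrite mulr_ge0// ltW.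
- by move=> i; exact: mMM'.
- move=> i; split; first exact: mMM.
  apply: (@le_lt_trans _ _ (Lp_norm P p (M (lift ord0 i)) +
    Lp_norm P p (M (widen_ord (leqnSn n) i)))%E).
    by apply: (Lp_norm_leD P p1 (mMM _ _) (mMT _) (mMT _)) => w; exact: ler_normB.
  by rewrite lte_add_pinfty//; [case: (Mp (lift ord0 i))|case: (Mp (widen_ord (leqnSn n) i))].
- by move=> i; exact: near.
Qed.

(** The conditional expectations are approximated by simple functions t_i, visible
    from level i on, and the f_i by simple functions u_i, put at level n so that no
    partition in use sees them. *)
Lemma stein_of_finite : stein_bound X p (4 * b)%:E.
Proof.
move=> n d T P F f Ef [sF FF] fp fE.
have Ep i : in_Lp P p (Ef i).
  by case: (sF i) => sFi FT; exact: cond_expectation_in_Lp (fE i) (fp i).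
have mf i : strongly_measurable d.-measurable%classic (f i) by case: (fp i).
have mE i : strongly_measurable d.-measurable%classic (Ef i) by case: (Ep i).
apply: (@lee_eps_const _ _ _ (4 * b * n%:R + n%:R * 3)) => [|e e0].
  by rewrite addr_ge0// mulr_ge0.
have /choice[t tP] : forall i, exists s : {fimfun T >-> X}, simple_for (F i) s /\
    (Lp_norm P p (fun w => Ef i w - s w)%R <= e%:E)%E.
  move=> i; case: (sF i) => sFi FT; apply: simple_dense => //.
    by case: (fE i).
  by case: (Ep i).
have /choice[u uP] : forall i, exists s : {fimfun T >-> X},
    simple_for d.-measurable%classic s /\
    (Lp_norm P p (fun w => f i w - s w)%R <= e%:E)%E.
  move=> i; apply: simple_dense => //; first exact: sigma_algebra_measurable.
  by case: (fp i).
pose s (j : 'I_n + 'I_n) := match j with inl i => t i | inr i => u i end.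
pose lev (j : 'I_n + 'I_n) : nat := match j with inl i => i | inr _ => n end.
have ms j : simple_for d.-measurable%classic (s j).
  case: j => i /=; last by case: (uP i).
  by move=> y; apply: (sF i).2; case: (tP i) => + _; exact.
pose f' (i : 'I_n) : T -> X := coordinate (s := s) (inr i) \o code s.
pose Ef' (i : 'I_n) := averaged P s lev i (inr i).
have mc v := measurable_code v ms.
have w0 := law_ge0 P (code s).
have mf' i : strongly_measurable d.-measurable%classic (f' i).
  exact: (strongly_measurable_coded_measurable mc).
have E'E i : (Lp_norm P p (fun w => Ef' i w - Ef i w)%R <= (3 * e)%:E)%E.
  apply: (@averaged_approx _ _ _ _ P _ s lev ms (F i) (f i) (Ef i) p e i (inl i) (inr i))
    => //; rewrite ?(ltW e0)//.
  - by case: (sF i).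
  - by case: (sF i).
  - case=> l /= li; last by rewrite leqNgt ltn_ord in li.
    by move=> y; apply: (FF l i li); case: (tP l) => + _; exact.
  - by case: (uP i).
  - by case: (tP i).
have fin : (cube_average P p Ef' <= (4 * b)%:E * cube_average P p f')%E.
  rewrite (cube_average_coded P mc (fun i : 'I_n => coordinate (s := s) (inr i)) pN0).
  rewrite (cube_average_coded P mc (fun i : 'I_n =>
    condexp (law P (code s)) (level_view lev i) (coordinate (s := s) (inr i))) pN0).
  rewrite -EFinM lee_fin.
  apply: (le_root p0 C0 (cube_sum_ge0 _ w0) (cube_sum_ge0 _ w0)).
  exact: (finite_stein p1 q1 pq b0 umd w0 (sum_law P mc)
    (@refining_level_view _ _ lev) (fun i : 'I_n => coordinate (s := s) (inr i))).
have ff' : (cube_average P p f' <= cube_average P p f + (n%:R * e)%:E)%E.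
  apply: (cube_average_perturb p1) => //; first exact: ltW.
  move=> i; rewrite Lp_norm_distC /f' (coordinateK s (inr i)).
  by case: (uP i).
have EE' : (cube_average P p Ef <= cube_average P p Ef' + (n%:R * (3 * e))%:E)%E.
  apply: (cube_average_perturb p1) => //.
  - by rewrite mulr_ge0// ltW.
  - by move=> i; exact: (in_Lp_coded P mc _ pN0).
  - by move=> i; rewrite Lp_norm_distC.
apply: (le_trans EE').
rewrite (mulrDl (4 * b * _)) EFinD addeA -(mulrA n%:R 3) leeD2r//.
apply: (le_trans fin).
rewrite -(mulrA (4 * b)) (EFinM (4 * b) _) -muleDr//; last first.
  rewrite ge0_adde_def// inE; first exact: poweR_ge0.
  by rewrite lee_fin mulr_ge0// ltW.
by rewrite lee_wpmul2l ?lee_fin.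
Qed.

End duality.

Theorem proposition5 (R : realType) (X : completeNormedModType R) :
  umd_plus (dual X) ->
  umd_minus X /\ forall p : R, 1 < p -> (stein_constant X p < +oo)%E.
Proof.
move=> umd.
have key (p : R) : 1 < p -> exists q b : R,
    [/\ 1 < q, p^-1 + q^-1 = 1, 0 < b & finite_umd_plus (dual X) q b].
  move=> p1; have [q q1 pq] := conjugate_exists p1.
  by have [b b0 ub] := umd_plus_finite umd q1; exists q, b.
split=> p p1; have [q [b [q1 pq b0 ub]]] := key p p1.
  exists (4 * b); first by rewrite mulr_gt0.
  by move=> n d T P F M; exact: (umd_minus_of_finite p1 q1 pq b0 ub).
rewrite /stein_constant (@le_lt_trans _ _ (4 * b)%:E) ?ltry//.
apply: ereal_inf_lbound; split; first by rewrite lte_fin mulr_gt0.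
exact: (stein_of_finite p1 q1 pq b0 ub).
Qed.
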